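(* Assume $F=f+h$ is uniformly convex of degree $q$ with constant $\sigma_q>0$, where $2\le q\le p+1$, that $F$ attains its minimum $F^*$ at $x^*$, and consider the Regularized Composite Tensor Method $x_0\in\operatorname{dom}h$, $x_{k+1}=T_H(x_k)$, $k\ge0$, with $H=pL_p$. Let $D=\sup_{x\in\operatorname{dom}h}\{\|x-x^*\|:F(x)\le F(x_0)\}<+\infty$ and $$\omega_{p,q}=\frac{p+1}{p!}\Big(\frac{q-1}{q}\Big)^{q-1}\frac{L_pD^{p-q+1}}{\sigma_q}.$$ Then $$F(x_k)-F^*\le\exp\Big(-\frac{k}{1+\omega_{p,q}^{1/p}}\Big)\big(F(x_0)-F^*\big),\qquad k\ge1.$$ Consequently, for any $\varepsilon>0$, to achieve $F(x_K)-F^*\le\varepsilon$ it is enough to take $$K=\Big\lceil(1+\omega_{p,q}^{1/p})\log\frac{F(x_0)-F^*}{\varepsilon}\Big\rceil+1.$$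
   Context: $\mathbb{E}$ is a finite-dimensional real vector space with dual $\mathbb{E}^*$; $B:\mathbb{E}\to\mathbb{E}^*$ is a fixed self-adjoint positive-definite operator, $\|x\|=\langle Bx,x\rangle^{1/2}$, $\|g\|_*=\langle g,B^{-1}g\rangle^{1/2}$. Let $p\ge 2$ be an integer, $h:\mathbb{E}\to\mathbb{R}\cup\{+\infty\}$ proper closed convex, and $f$ convex and $p$ times differentiable on an open convex set containing $\operatorname{dom}h$, with $\|D^pf(x)-D^pf(y)\|\le L_p\|x-y\|$ for $x,y\in\operatorname{dom}h$, $0<L_p<\infty$, where for a symmetric $p$-linear form $\|A\|=\max_{\|u\|\le1}|A[u]^p|$. $F=f+h$. Taylor polynomial $\Omega_p(f,x;y)=f(x)+\sum_{k=1}^p\frac1{k!}D^kf(x)[y-x]^k$. For $x\in\operatorname{dom}h$, $T_H(x)=\arg\min_{y\in\mathbb{E}}\{\Omega_p(f,x;y)+\frac{H}{(p+1)!}\|y-x\|^{p+1}+h(y)\}$. Uniform convexity of degree $q$ with constant $\sigma_q$: $\langle G_x-G_y,x-y\rangle\ge\sigma_q\|x-y\|^q$ for all $x,y\in\operatorname{dom}h$, $G_x\in\partial F(x)$, $G_y\in\partial F(y)$. $\log$ is the natural logarithm. *)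

(* Defs.v *)
From HB Require Import structures.
From mathcomp Require Import all_boot all_order all_algebra.
From mathcomp Require Import all_classical all_reals all_analysis.
Set Implicit Arguments. Unset Strict Implicit. Unset Printing Implicit Defensive.
Import Order.TTheory GRing.Theory Num.Theory.
Import numFieldNormedType.Exports.
Local Open Scope classical_set_scope.
Local Open Scope ring_scope.

Section Defs.
Variables (R : realType) (n : nat).
Notation E := 'rV[R]_n.

(* dual pairing <g, x> for g in E^* (identified with row vectors) *)
Definition dualp (g x : E) : R := \sum_(i < n) g 0 i * x 0 i.

Definition spd (B : 'M[R]_n) : Prop :=
  B^T = B /\ forall v : E, v != 0 -> 0 < \sum_(i < n) \sum_(j < n) v 0 i * B i j * v 0 j.

Definition Bnorm (B : 'M[R]_n) (x : E) : R :=
  Num.sqrt (\sum_(i < n) \sum_(j < n) x 0 i * B i j * x 0 j).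

Fixpoint diffn (k : nat) (U : set E) (f : E -> R) : Prop :=
  match k with
  | 0 => True
  | k'.+1 => (forall x, U x -> differentiable f x) /\
             forall u : E, diffn k' U (fun y => 'd f y u)
  end.

Fixpoint Dd (k : nat) (u : E) (f : E -> R) : E -> R :=
  match k with
  | 0 => f
  | k'.+1 => Dd k' u (fun y => 'd f y u)
  end.

Definition taylor (p : nat) (f : E -> R) (x y : E) : R :=
  f x + \sum_(1 <= k < p.+1) (k`!%:R)^-1 * Dd k (y - x) f x.

Definition domh (h : E -> \bar R) : set E := [set x | (h x < +oo)%E].

Definition ext_convex (h : E -> \bar R) : Prop :=
  forall (x y : E) (t : R), 0 < t < 1 ->
    (h (t *: x + (1 - t) *: y)%R <= t%:E * h x + (1 - t)%:E * h y)%E.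

Definition proper_fun (h : E -> \bar R) : Prop :=
  (forall x, h x != -oo%E) /\ exists x, (h x < +oo)%E.

Definition closed_fun (h : E -> \bar R) : Prop :=
  closed [set z : E * R | (h z.1 <= z.2%:E)%E].

Definition convex_set_on (U : set E) : Prop :=
  forall x y (t : R), U x -> U y -> 0 <= t <= 1 -> U (t *: x + (1 - t) *: y).

Definition convex_on (U : set E) (f : E -> R) : Prop :=
  forall x y (t : R), U x -> U y -> 0 <= t <= 1 ->
    f (t *: x + (1 - t) *: y) <= t * f x + (1 - t) * f y.

Definition subdiff (F : E -> \bar R) (x : E) : set E :=
  [set g | forall y, (F x + (dualp g (y - x))%:E <= F y)%E].

End Defs.

(* Main.v *)
(** At the step [T] from [x], put [u = T - x] and [c = Lp / p!].  First-order
    optimality of [T] gives a subgradient [G] of [F] at [T] equal to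
    [grad f(T) - grad Omega(T) - p c |u|^(p-1) B u], and the Taylor remainder of
    [grad f] has dual norm at most [c |u|^p].  Expanding the square of this bound
    and applying Young's inequality yields [<G, x - T> ^ p >= |G|^(p+1) / ((p+1) c)],
    a lower bound on [F(x) - F(T)].  Uniform convexity bounds
    [(F(T) - F* ) ^ (q-1)] by a multiple of [|G|^q], and [F(T) - F* <= |G| D];
    multiplying these two bounds gives
    [F(T) - F* <= omega^(1/p) (F(x) - F(T))], hence the linear rate.

    Two points need work.  The Lipschitz hypothesis only controls [D^p f] on the
    diagonal; passing to [D^p f [u]^(p-1) [w]] without losing a constant is
    Banach's theorem on symmetric forms, obtained from a Bernstein-Szego
    inequality on the circle.  Monotonicity of the subgradients must be
    integrated along a segment on which subgradients may fail to exist; they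
    are replaced by subgradients at proximal points. *)
Require Import Defs.
From HB Require Import structures.
From mathcomp Require Import all_boot all_order all_algebra.
From mathcomp Require Import cyclic separable cyclotomic.
From mathcomp Require Import all_classical all_reals all_analysis.
From mathcomp Require Import complex ring lra.
Set Implicit Arguments. Unset Strict Implicit. Unset Printing Implicit Defensive.
Import Order.TTheory GRing.Theory Num.Theory.
Import numFieldNormedType.Exports.
Local Open Scope classical_set_scope.
Local Open Scope ring_scope.

(** * Bernstein-Szego inequality *)

Lemma prim_root_neq0 (F : fieldType) (p : nat) (eta : F) :
  (0 < p)%N -> p.-primitive_root eta -> eta != 0.
Proof.
move=> p0 /prim_expr_order; apply: contra_eq_neq => ->.
by rewrite expr0n gtn_eqF // eq_sym oner_neq0.
Qed.

(** Orthogonality of the characters of the cyclic group of order [p]: the ratio is a [p]-th root of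
    unity, so the geometric sum vanishes unless the ratio is [1]. *)
Lemma sum_prim_root_exp (F : fieldType) (p : nat) (eta : F) (a b : nat) :
  (0 < p)%N -> p.-primitive_root eta -> (b < p)%N ->
  \sum_(j < p) (eta ^+ a / eta ^+ b) ^+ j = if b == (a %% p)%N then p%:R else 0.
Proof.
move=> p0 eta_prim ltbp.
have eta0 := prim_root_neq0 p0 eta_prim.
have eta_b0 : eta ^+ b != 0 by rewrite expf_neq0.
have -> : (b == a %% p)%N = (eta ^+ a / eta ^+ b == 1).
  rewrite -(inj_eq (mulIf eta_b0)) divfK // mul1r (eq_prim_root_expr eta_prim).
  by rewrite eq_sym (modn_small ltbp).
case: eqP => [->|/eqP ne1].
  by rewrite (eq_bigr (fun=> 1)) ?sumr_const ?card_ord // => j _; rewrite expr1n.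
have /eqP := subrX1 (eta ^+ a / eta ^+ b) p.
rewrite expr_div_n -!exprM ![(_ * p)%N]mulnC !exprM (prim_expr_order eta_prim).
rewrite !expr1n divr1 subrr eq_sym mulf_eq0 subr_eq0 (negPf ne1) /=.
by move=> /eqP.
Qed.

(** After expansion, orthogonality keeps only [b = (a + k) mod p], leaving [y ^+ p] to the power
    [(a + k) %/ p]. As [k <= p], this quotient is [0] for the first [p - k] values of [a] and [1]
    for the other [k]. *)
Lemma fejer_moment (F : fieldType) (p k : nat) (eta y : F) :
  (0 < p)%N -> p.-primitive_root eta -> y != 0 -> (k <= p)%N ->
  \sum_(j < p) (\sum_(a < p) (y * eta ^+ j) ^+ a)
     * (\sum_(b < p) (y * eta ^+ j) ^- b) * (y * eta ^+ j) ^+ k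
  = p%:R * ((p - k)%:R + k%:R * y ^+ p).
Proof.
move=> p0 eta_prim y0 lekp.
have eta0 := prim_root_neq0 p0 eta_prim.
transitivity (\sum_(a < p) \sum_(b < p) y ^+ (a + k) / y ^+ b *
    \sum_(j < p) (eta ^+ (a + k) / eta ^+ b) ^+ j).
  under eq_bigr => j _.
    rewrite big_distrlr /= mulr_suml; under eq_bigr => a _ do rewrite mulr_suml.
    over.
  rewrite exchange_big /=; apply: eq_bigr => a _.
  rewrite exchange_big /=; apply: eq_bigr => b _.
  rewrite mulr_sumr; apply: eq_bigr => j _.
  by rewrite mulrAC -exprD expr_div_n !exprMn invfM -!exprM !(mulnC j) mulrACA.
transitivity (\sum_(a < p) p%:R * (y ^+ p) ^+ ((a + k) %/ p)).
  apply: eq_bigr => a _.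
  under eq_bigr => b _ do rewrite sum_prim_root_exp //.
  have ltm : ((a + k) %% p < p)%N by rewrite ltn_mod.
  rewrite (bigD1 (Ordinal ltm)) //= eqxx big1 => [|b /negPf nb]; last first.
    by rewrite -val_eqE /= in nb; rewrite nb mulr0.
  rewrite addr0 mulrC {1}(divn_eq (a + k) p) exprD mulfK ?expf_neq0 //.
  by rewrite mulnC exprM.
rewrite -mulr_sumr; congr (_ * _).
rewrite -(big_mkord xpredT (fun a => (y ^+ p) ^+ ((a + k) %/ p))).
rewrite (@big_cat_nat _ _ _ (p - k)%N) ?leq_subr //=; congr (_ + _).
  rewrite big_nat (eq_bigr (fun=> 1)) => [|a /andP[_ lta]].
    by rewrite -big_nat sumr_const_nat subn0.
  by rewrite divn_small ?expr0 // addnC -ltn_subRL.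
rewrite big_nat (eq_bigr (fun=> y ^+ p)) => [|a /andP[gea lta]].
  by rewrite -big_nat sumr_const_nat subKn // mulr_natl.
have -> : ((a + k) %/ p = 1)%N; last by rewrite expr1.
apply/eqP; rewrite eqn_leq -ltnS ltn_divLR // leq_divRL // mul1n.
by rewrite addnC -leq_subLR gea mulSn mul1n andbT -addnS leq_add.
Qed.

Lemma prim_root_exists (C : numClosedFieldType) (n : nat) :
  (0 < n)%N -> exists z : C, n.-primitive_root z.
Proof.
move=> n0.
pose q : {poly C} := 'X^n - 1.
have [rs def_q] := closed_field_poly_normal q.
have q1 : lead_coef q = 1 by apply/eqP; exact: monicXnsubC.
rewrite q1 scale1r in def_q.
have rsn : size rs = n.
  by apply/eqP; rewrite -eqSS -(size_prod_XsubC rs id) -def_q size_XnsubC.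
suff /hasP[z _ ?] : has n.-primitive_root rs by exists z.
apply: has_prim_root => //; last by rewrite rsn.
  by apply/allP => z; rewrite -root_prod_XsubC -def_q.
rewrite -separable_prod_XsubC -def_q separable_Xn_sub_1 //.
by rewrite pnatr_eq0 -lt0n.
Qed.

(* The weights [|\sum_(a < p) z_j ^+ a| ^+ 2 / p ^+ 2] at the [p]-th roots [z_j]
   of [s] are nonnegative and sum to [1]: they are values of the Fejer kernel. *)
Lemma bernstein_circle (C : numClosedFieldType) (p : nat) (q : {poly C})
    (s M : C) :
  (0 < p)%N -> (size q <= p.+1)%N -> `|s| = 1 ->
  (forall z, `|z| = 1 -> `|q.[z]| <= M) ->
  `|p%:R * q.[1] + (s - 1) * q^`().[1]| <= p%:R * M.
Proof.
move=> p0 szq s1 qM.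
have [eta eta_prim] := prim_root_exists C p0.
pose y := p.-root s; have yp : y ^+ p = s by rewrite rootCK.
have norm1 (z : C) : `|z ^+ p| = 1 -> `|z| = 1.
  rewrite normrX => h; apply/eqP.
  by rewrite -(pexpr_eq1 p0) ?h.
pose z (j : 'I_p) := y * eta ^+ j.
have y1 : `|y| = 1 by apply: norm1; rewrite yp.
have eta1 : `|eta| = 1 by apply: norm1; rewrite (prim_expr_order eta_prim) normr1.
have z1 j : `|z j| = 1 by rewrite normrM normrX y1 eta1 expr1n mulr1.
have y0 : y != 0 by rewrite -normr_gt0 y1.
pose mu j := (\sum_(a < p) z j ^+ a) * (\sum_(b < p) z j ^- b).
(* On the unit circle the inverse is the conjugate, so each weight is a squared modulus. *)
have muE j : mu j = `|\sum_(a < p) z j ^+ a| ^+ 2.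
  rewrite normCK; congr (_ * _); rewrite rmorph_sum; apply: eq_bigr => a _ /=.
  by rewrite rmorphXn /= -exprVn invC_norm z1 expr1n invr1 mul1r.
have pC : p%:R != 0 :> C by rewrite pnatr_eq0 -lt0n.
have mom k : (k <= p)%N ->
    \sum_(j < p) mu j * z j ^+ k = p%:R * ((p - k)%:R + k%:R * s).
  by move=> lekp; rewrite -yp -(fejer_moment p0 eta_prim y0 lekp).
have id : p%:R * (p%:R * q.[1] + (s - 1) * q^`().[1])
    = \sum_(j < p) mu j * q.[z j].
  under [RHS]eq_bigr => j _.
    rewrite (horner_coef_wide _ szq) mulr_sumr; over.
  rewrite exchange_big /= (horner_coef_wide _ szq).
  have szq' : (size q^`() <= p)%N.
    have [->|q0] := eqVneq q 0; first by rewrite deriv0 size_poly0.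
    by rewrite -ltnS (leq_trans (lt_size_deriv q0) szq).
  rewrite (horner_coef_wide _ szq') !mulr_sumr.
  have -> : \sum_(i < p) (s - 1) * (q^`()`_i * 1 ^+ i) =
      \sum_(i < p.+1) (s - 1) * (q`_i *+ i).
    rewrite big_ord_recl /= mulr0n mulr0 add0r; apply: eq_bigr => i _.
    by rewrite coef_deriv expr1n mulr1.
  rewrite -big_split /= mulr_sumr; apply: eq_bigr => k _.
  under eq_bigr => j _ do rewrite mulrCA.
  rewrite -mulr_sumr mom -1?ltnS // expr1n natrB -1?ltnS // -mulr_natr; ring.
have : `|p%:R * (p%:R * q.[1] + (s - 1) * q^`().[1])| <= p%:R * (p%:R * M).
  rewrite id (le_trans (ler_norm_sum _ _ _)) //.
  have -> : p%:R * (p%:R * M) = \sum_(j < p) mu j * M.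
    rewrite -mulr_suml mulrA; congr (_ * _).
    have := mom 0%N (leq0n p); rewrite subn0 mul0r addr0 => <-.
    by apply: eq_bigr => j _; rewrite expr0 mulr1.
  apply: ler_sum => j _; rewrite normrM muE ger0_norm ?exprn_ge0 //.
  by rewrite ler_wpM2l ?exprn_ge0 // qM.
by rewrite normrM normr_nat ler_pM2l // ltr0n.
Qed.
(** The conclusion bounds the gradient at [(1, 0)] of a binary form bounded by [M] on the circle.
    With [w = a + i b] and [z] the square of the conjugate of [w], the form is a unimodular factor
    times [q(z)], where [q] has degree at most [p], so [bernstein_circle] applies. The polynomials
    [A] and [B] are [a] and [b] times the conjugate of [w], written in [z]. *)
Lemma bernstein_szego (R : rcfType) (p : nat) (c : nat -> R) (M : R) :
  (0 < p)%N ->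
  (forall a b, a ^+ 2 + b ^+ 2 = 1 ->
     `|\sum_(m < p.+1) c m * (a ^+ (p - m) * b ^+ m)| <= M) ->
  forall a b, a ^+ 2 + b ^+ 2 = 1 -> `|p%:R * c 0%N * a + c 1%N * b| <= p%:R * M.
Proof.
move=> p0 cM al be ab1.
pose i : R[i] := 'i%C.
have i2 : i * i = -1 by rewrite -expr2; exact: sqr_i R.
pose A : {poly R[i]} := 2^-1 *: (1 + 'X).
pose B : {poly R[i]} := (- i / 2) *: (1 - 'X).
pose q := \sum_(m < p.+1) (c m)%:C%C *: (A ^+ (p - m) * B ^+ m).
have A1 : A.[1] = 1 by rewrite /A !hornerE; field.
have B1 : B.[1] = 0 by rewrite /B !hornerE subrr mulr0.
have A'1 : A^`().[1] = 2^-1.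
  by rewrite /A derivZ derivD derivX -polyC1 derivC !hornerE.
have B'1 : B^`().[1] = i / 2.
  by rewrite /B derivZ derivB derivX -polyC1 derivC !hornerE; ring.
have szq : (size q <= p.+1)%N.
  rewrite (leq_trans (size_sum _ _ _)) //; apply/bigmax_leqP => m _.
  rewrite (leq_trans (size_scale_leq _ _)) // (leq_trans (size_polyMleq _ _)) //.
  have szA : (size A <= 2)%N.
    by rewrite (leq_trans (size_scale_leq _ _)) // addrC -[1]opprK -polyC1 -polyCN size_XsubC.
  have szB : (size B <= 2)%N.
    by rewrite (leq_trans (size_scale_leq _ _)) // -opprB size_polyN size_XsubC.
  have szX (D : {poly R[i]}) k : (size D <= 2)%N -> (size (D ^+ k) <= k.+1)%N.
    move=> szD; rewrite (leq_trans (size_poly_exp_leq _ _)) // ltnS.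
    by rewrite -{2}[k]mul1n leq_mul2r; case: (size D) szD => [|[|[|]]] //=; rewrite orbT.
  have := leq_add (szX A (p - m)%N szA) (szX B m szB).
  rewrite addSn addnS subnK -1?ltnS //.
  by case: (_ + _)%N => // k; rewrite ltnS.
have q1 : q.[1] = (c 0%N)%:C%C.
  rewrite horner_sum big_ord_recl big1 => [|m _].
    by rewrite hornerZ hornerM !horner_exp A1 expr1n expr0 !mulr1 addr0.
  by rewrite hornerZ hornerM !horner_exp B1 exprS mul0r !mulr0.
(* Since [B] vanishes at [1], only the terms [m = 0] and [m = 1] contribute. *)
have q'1 : q^`().[1] = (p%:R * (c 0%N)%:C%C + i * (c 1%N)%:C%C) / 2.
  have dE m : ((c m)%:C%C *: (A ^+ (p - m) * B ^+ m))^`().[1] =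
     (c m)%:C%C * (2^-1 * 0 ^+ m *+ (p - m) + i / 2 * 0 ^+ m.-1 *+ m).
    rewrite derivZ derivM !deriv_exp hornerZ hornerD !hornerM !hornerMn !hornerM !horner_exp.
    by rewrite A1 B1 A'1 B'1 !expr1n mulr1 mul1r mulrnAl.
  rewrite (linear_sum deriv) horner_sum big_ord_recl dE.
  transitivity ((c 0%N)%:C%C * (2^-1 *+ p) + (c 1%N)%:C%C * (i / 2)).
    congr (_ + _); first by rewrite subn0 mulr0n addr0 expr0 mulr1.
    clear q szq q1 cM; case: p p0 dE => // p _ dE.
    rewrite big_ord_recl dE big1 => [|m _]; last by rewrite dE /= !exprS !mul0r !mulr0 !mul0rn addr0 mulr0.
    by rewrite addr0 /= !expr0 exprS mul0r mulr0 mul0rn add0r mulr1.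
  by rewrite -mulr_natr; field.
pose v := (al +i* be)%C.
have vJ : v * v^*%C = 1.
  by rewrite /v; apply/eqP; rewrite eq_complex /=; apply/andP; split; apply/eqP; lra.
have normJ (w : R[i]) : w * w^*%C = 1 -> `|w| = 1.
  move=> wJ; have /eqP : `|w| ^+ 2 = 1 by rewrite sqr_normc.
  by rewrite sqrp_eq1 ?normr_ge0 // => /eqP.
have ReIm (w : R[i]) : w * w^*%C = 1 ->
    [/\ complex.Re w ^+ 2 + complex.Im w ^+ 2 = 1,
    w^*%C * (complex.Re w)%:C%C = (1 + w^*%C ^+ 2) / 2 &
    w^*%C * (complex.Im w)%:C%C = (- i / 2) * (1 - w^*%C ^+ 2)].
  move=> wJ; split.
  - by apply: complexI; rewrite add_Re2_Im2 sqr_normc wJ.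
  - by rewrite ReJ_add mulrA mulrDr -expr2 [_^*%C * w]mulrC wJ.
  - by rewrite ImJ_sub -/i; transitivity (- i / 2 * (w * w^*%C - w^*%C ^+ 2)); [ring | rewrite wJ].
(* Every unimodular [z] is the square of the conjugate of some unimodular [w], whose real and
   imaginary parts give a point of the circle. *)
have qM (z : R[i]) : `|z| = 1 -> `|q.[z]| <= M%:C%C.
  move=> z1; pose w := (sqrtc z)^*%C.
  have wz : w^*%C ^+ 2 = z by rewrite conjcK sqr_sqrtc.
  have w1 : `|w^*%C| = 1.
    by apply/eqP; rewrite -sqrp_eq1 ?normr_ge0 // -normrX wz z1.
  have wJ : w * w^*%C = 1.
    by rewrite -sqr_normc -normcJ w1 expr1n.
  have [ab1' wa wb] := ReIm _ wJ.
  set a := complex.Re w in ab1' wa; set b := complex.Im w in ab1' wb.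
  have -> : q.[z] = w^*%C ^+ p * (\sum_(m < p.+1) c m * (a ^+ (p - m) * b ^+ m))%:C%C.
    rewrite horner_sum rmorph_sum mulr_sumr; apply: eq_bigr => m _.
    have Az : A.[z] = w^*%C * a%:C%C by rewrite wa /A !hornerE -wz mulrC.
    have Bz : B.[z] = w^*%C * b%:C%C by rewrite wb /B !hornerE -wz.
    rewrite hornerZ hornerM !horner_exp Az Bz !rmorphM !rmorphXn /= !exprMn.
    have -> : w^*%C ^+ p = w^*%C ^+ (p - m) * w^*%C ^+ m.
      by rewrite -exprD subnK // -ltnS.
    ring.
  rewrite normrM normrX w1 expr1n mul1r.
  by rewrite normc_def /= expr0n addr0 sqrtr_sqr lecR cM.
have s1 : `|v^*%C ^+ 2| = 1 by rewrite normrX normcJ normJ // expr1n.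
have := bernstein_circle p0 szq s1 qM.
rewrite q1 q'1.
(* With [s] the square of the conjugate of [v], one has [s - 1 = -2 i be] times that conjugate; the
   factor of modulus one then comes out and a real number is left. *)
have -> : p%:R * (c 0%N)%:C%C + (v^*%C ^+ 2 - 1) * ((p%:R * (c 0%N)%:C%C + i * (c 1%N)%:C%C) / 2) =
   v^*%C * (p%:R * c 0%N * al + c 1%N * be)%:C%C.
  have e : v^*%C ^+ 2 - 1 = v^*%C * (v^*%C - v) by rewrite mulrBr [_ * v]mulrC vJ.
  have e1 : p%:R * (c 0%N)%:C%C = v^*%C * (v * (p%:R * (c 0%N)%:C%C)).
    by rewrite mulrA [_ * v]mulrC vJ mul1r.
  rewrite e {1}e1 -mulrA -mulrDr; congr (_ * _).
  rewrite rmorphD !rmorphM /= rmorph_nat.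
  have vE : v = al%:C%C + i * be%:C%C by rewrite [v]complexE.
  have vJE : (al -i* be)%C = al%:C%C - i * be%:C%C.
    by rewrite /i; simpc.
  rewrite vJE vE.
  transitivity (p%:R * (c 0%N)%:C%C * al%:C%C - (i * i) * be%:C%C * (c 1%N)%:C%C); first by field.
  by rewrite i2; ring.
rewrite normrM normcJ (normJ v) // mul1r.
by rewrite normc_def /= expr0n addr0 sqrtr_sqr -(rmorph_nat (real_complex R)) -rmorphM lecR.
Qed.
(** * Iterated directional derivatives *)

Section DirectionalDerivatives.
Variables (R : realType) (n : nat).
Notation E := 'rV[R]_n.
Implicit Types (f g : E -> R) (U : set E) (u v w x y : E).

Lemma is_derive_line f x u (s : R) : differentiable f (x + s *: u) ->
  is_derive s 1 (fun t => f (x + t *: u)) ('d f (x + s *: u) u).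
Proof.
move=> df.
have e : (fun h : R => h^-1 *: (((fun t => f (x + t *: u)) \o shift s) (h *: 1) - f (x + s *: u)))
  = (fun h => h^-1 *: ((f \o shift (x + s *: u)) (h *: u) - f (x + s *: u))).
  apply/funext => h; congr (_ *: (f _ - _)) => /=.
  by rewrite -[h%:A]/(h * 1) mulr1 scalerDl addrCA.
by split; [rewrite /derivable e; exact: diff_derivable | rewrite -deriveE // /derive e].
Qed.

Lemma diff_approx f x (e : R) : differentiable f x -> 0 < e ->
  exists2 d : R, 0 < d &
    forall h, `|h| < d -> `|f (x + h) - f x - 'd f x h| <= e * `|h|.
Proof.
move=> df e0; have /diff_locally fE := df.
have /eqaddoP := fE.
move=> /(_ _ e0) /nbhs_ballP[d /= d0 dE]; exists d => // h hd.
have := dE h; rewrite -ball_normE /= sub0r normrN => /(_ hd).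
by rewrite -[(_ - _) h]/(f (h + x) - (f x + 'd f x h)) [h + x]addrC opprD addrA.
Qed.

Section second_difference.
Variables (f : E -> R) (U : set E) (a : E).
Hypotheses (Uo : open U) (Ua : U a) (df : forall y, U y -> differentiable f y).

Let Delta u w (t : R) :=
  f (a + t *: u + t *: w) - f (a + t *: u) - (f (a + t *: w) - f a).

(** The mean value theorem in direction [u], applied to the increment in direction [w], turns the
    second difference into an increment of ['d f y u], which is then expanded to first order at
    [a]. *)
Lemma second_difference_approx u w (l e : R) :
  differentiable (fun y => 'd f y u) a -> 'd (fun y => 'd f y u) a w = l -> 0 < e ->
  exists2 r : R, 0 < r & forall t, 0 < t -> t < r ->
    `|Delta u w t - t ^+ 2 * l| <= e * t ^+ 2.
Proof.
set g := fun y => 'd f y u; move=> dg lE e0.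
(* All points used lie within [t * N] of [a]. *)
pose N := `|u| + `|w| + 1.
have N0 : 0 < N by rewrite ltr_wpDl ?addr_ge0.
have [d d0 dE] := diff_approx dg (divr_gt0 e0 (mulr_gt0 (ltr0n _ 2) N0)).
have [d' /= d'0 dU] : exists2 d', 0 < d' & forall h, `|h| < d' -> U (a + h).
  have /nbhs_ballP[d' /= d'0 dU] := open_nbhs_nbhs (conj Uo Ua).
  exists d' => // h hd; apply: dU; rewrite -ball_normE /=.
  by rewrite opprD addrA subrr sub0r normrN.
exists (Num.min (d / N) (d' / N)); first by rewrite lt_min !divr_gt0.
move=> t t0; rewrite lt_min !ltr_pdivlMr // => /andP[tN tN'].
have small (s s' : R) : 0 <= s <= t -> 0 <= s' <= t -> `|s *: u + s' *: w| <= t * N.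
  move=> /andP[s0 st] /andP[s0' st'].
  rewrite (le_trans (ler_normD _ _)) // !normrZ !ger0_norm // /N !mulrDr mulr1.
  have := ler_wpM2r (normr_ge0 u) st; have := ler_wpM2r (normr_ge0 w) st'.
  lra.
pose psi s := f (a + t *: w + s *: u) - f (a + s *: u).
have ts s : s \in `[0, t] -> 0 <= s <= t by rewrite in_itv.
have t00 : 0 <= t <= t by rewrite lexx ltW.
have z00 : (0 : R) <= 0 <= t by rewrite lexx ltW.
have psi' s : s \in `[0, t] -> is_derive s 1 psi (g (a + t *: w + s *: u) - g (a + s *: u)).
  move=> /ts hs; apply: is_deriveB; apply: is_derive_line; apply: df.
    by rewrite addrAC -addrA; apply: dU; rewrite (le_lt_trans (small _ _ hs t00)).
  by rewrite -[s *: u]addr0 -(scale0r w); apply: dU; rewrite (le_lt_trans (small _ _ hs z00)).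
have psi'o s : s \in `]0, t[ -> is_derive s 1 psi (g (a + t *: w + s *: u) - g (a + s *: u)).
  by move=> /subset_itv_oo_cc; exact: psi'.
have psic : {within `[0, t], continuous psi}.
  by apply: derivable_within_continuous => s /psi' ?; exact: ex_derive.
have [xi /ts xit] := MVT_segment (ltW t0) psi'o psic.
rewrite subr0 => psiE.
have -> : Delta u w t = (g (a + t *: w + xi *: u) - g (a + xi *: u)) * t.
  by rewrite -psiE /psi !scale0r !addr0 /Delta (addrAC a); ring.
have h1 := dE (xi *: u + t *: w) (le_lt_trans (small _ _ xit t00) tN).
have h2 := dE (xi *: u + 0 *: w) (le_lt_trans (small _ _ xit z00) tN).
rewrite scale0r addr0 in h2.
rewrite linearD /= in h1.
have -> : a + t *: w + xi *: u = a + (xi *: u + t *: w) by rewrite addrAC addrA.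
set L := 'd g a in lE h1 h2 *.
have Lw : L (t *: w) = t * l by rewrite linearZ /= -lE.
rewrite Lw in h1.
set X := g (a + _) in h1 *; set Y := g (a + _) in h2 *; set Z := g a in h1 h2; set V := L (xi *: u) in h1 h2.
have hN s s' (hs : 0 <= s <= t) (hs' : 0 <= s' <= t) :
    e / (2 * N) * `|s *: u + s' *: w| <= e * t / 2.
  rewrite (le_trans (ler_wpM2l _ (small _ _ hs hs'))) //.
    by rewrite divr_ge0 ?mulr_ge0 // ltW.
  by have -> : e / (2 * N) * (t * N) = e * t / 2 by field; rewrite gt_eqF.
have := le_trans h1 (hN _ _ xit t00).
have := hN _ _ xit z00; rewrite scale0r addr0 => /(le_trans h2).
rewrite !ler_norml => /andP[h3 h4] /andP[h5 h6].
clearbody X Y Z V.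
have -> : (X - Y) * t - t ^+ 2 * l = (X - Y - t * l) * t by ring.
have -> : e * t ^+ 2 = (e * t) * t by ring.
rewrite -mulNr !ler_pM2r //; apply/andP; split; clear -h3 h4 h5 h6; lra.
Qed.
End second_difference.

(** The second difference is symmetric in [u] and [w], and divided by [t ^+ 2] it approximates both
    mixed derivatives. *)
Lemma diff_diffC f U u w x : open U -> U x ->
  (forall y, U y -> differentiable f y) ->
  differentiable (fun y => 'd f y u) x -> differentiable (fun y => 'd f y w) x ->
  'd (fun y => 'd f y u) x w = 'd (fun y => 'd f y w) x u.
Proof.
move=> Uo Ux df du dw.
suff eq (l l' : R) : 'd (fun y => 'd f y u) x w = l -> 'd (fun y => 'd f y w) x u = l' -> l = l'.
  exact: eq.
move=> lE l'E.
suff le e : 0 < e -> (l <= l' + e) && (l' <= l + e).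
  by apply/le_anti/andP; split; apply/ler_addgt0Pr => e /le /andP[].
move=> e0.
have e2 : 0 < e / 2 by rewrite divr_gt0.
have [r r0 rE] := second_difference_approx Uo Ux df du lE e2.
have [s s0 sE] := second_difference_approx Uo Ux df dw l'E e2.
pose t := Num.min r s / 2.
have t0 : 0 < t by rewrite divr_gt0 // lt_min r0.
have [tr ts] : t < r /\ t < s.
  have : Num.min r s / 2 < Num.min r s by rewrite ltr_pdivrMr // mulr_natr mulr2n ltrDl lt_min r0.
  by rewrite [X in _ < X -> _]/(Num.min r s) lt_min => /andP.
have := rE t t0 tr; have := sE t t0 ts.
rewrite [x + t *: w + _]addrAC.
move: (f (x + t *: u + t *: w)) (f (x + t *: u)) (f (x + t *: w)) (f x) => A B C F0.
clear lE l'E.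
rewrite !ler_norml => /andP[h1 h2] /andP[h3 h4].
have t2 : 0 < t ^+ 2 by rewrite exprn_gt0.
clear -h1 h2 h3 h4 t2.
by apply/andP; split; rewrite -(ler_pM2l t2); lra.
Qed.

Lemma diffnW k U f : diffn k.+1 U f -> diffn k U f.
Proof.
elim: k f => // k IH f [df dfu]; split=> // u; exact/IH/dfu.
Qed.

Lemma diffn_leq j k U f : (j <= k)%N -> diffn k U f -> diffn j U f.
Proof.
elim: k => [|k IH]; first by rewrite leqn0 => /eqP->.
by rewrite leq_eqVlt => /orP[/eqP->//|jk] /diffnW; exact: IH.
Qed.

Lemma diff_lin_near U f g1 g2 (a b : R) v y : open U -> U y ->
  differentiable f y -> differentiable g1 y -> differentiable g2 y ->
  (forall z, U z -> f z = a * g1 z + b * g2 z) ->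
  'd f y v = a * 'd g1 y v + b * 'd g2 y v.
Proof.
move=> Uo Uy df d1 d2 fE.
have D1 : derivable g1 y v by exact: diff_derivable.
have D2 : derivable g2 y v by exact: diff_derivable.
transitivity ('D_v f y); first by rewrite (deriveE v df).
transitivity (a * 'D_v g1 y + b * 'D_v g2 y); last first.
  by congr (a * _ + b * _); exact: deriveE.
have -> : 'D_v f y = 'D_v (a *: g1 + b *: g2) y.
  apply: near_eq_derive; near=> z; apply: fE; near: z; exact: open_nbhs_nbhs.
by rewrite (deriveD (derivableZ D1) (derivableZ D2)) (deriveZ _ D1) (deriveZ _ D2).
Unshelve. all: by end_near. Qed.

Lemma Dd_lin k U f g1 g2 a b v : open U ->
  diffn k U f -> diffn k U g1 -> diffn k U g2 ->
  (forall y, U y -> f y = a * g1 y + b * g2 y) ->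
  forall y, U y -> Dd k v f y = a * Dd k v g1 y + b * Dd k v g2 y.
Proof.
move=> Uo; elim: k f g1 g2 => [|k IH] f g1 g2 //= [df dfu] [d1 d1u] [d2 d2u] fE.
apply: (IH _ _ _ (dfu v) (d1u v) (d2u v)) => y Uy.
exact: (diff_lin_near v Uo Uy (df y Uy) (d1 y Uy) (d2 y Uy) fE).
Qed.

Lemma Dd_congr k U f g v : open U -> diffn k U f -> diffn k U g ->
  (forall y, U y -> f y = g y) -> forall y, U y -> Dd k v f y = Dd k v g y.
Proof.
move=> Uo df dg fg y Uy.
rewrite (@Dd_lin k U f g g 1 0 v) // ?mul1r ?mul0r ?addr0 // => z Uz.
by rewrite mul1r mul0r addr0 fg.
Qed.

(* [Dd k (a *: u + b *: w) f y] is a binary form in [a] and [b]; symmetry of the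
   iterated derivatives identifies the coefficient of [a ^+ k.-1 * b]. *)
Lemma Dd_binary_form k U f u w : open U -> diffn k U f ->
  exists c : nat -> E -> R, forall y, U y ->
    [/\ forall a b, Dd k (a *: u + b *: w) f y
          = \sum_(m < k.+1) c m y * (a ^+ (k - m) * b ^+ m),
        c 0%N y = Dd k u f y &
        (0 < k)%N -> c 1%N y = k%:R * Dd k.-1 u (fun z => 'd f z w) y].
Proof.
move=> Uo; elim: k f => [|k IH] f dkf.
  by exists (fun _ => f) => y Uy; split=> // a b; rewrite big_ord1 /= !expr0 !mulr1.
have [df dfu] := dkf.
have [cu cuP] := IH _ (dfu u); have [cw cwP] := IH _ (dfu w).
(* Pascal's recursion, from splitting the first direction into [a *: u] and [b *: w]. The guard
   discards [cu k.+1], which is not a coefficient of the form of degree [k]. *)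
exists (fun m y => if m is m'.+1 then (if (m <= k)%N then cu m y else 0) + cw m' y else cu 0%N y).
move=> y Uy; have [cuE cu0 cu1] := cuP _ Uy; have [cwE cw0 cw1] := cwP _ Uy.
split=> [a b||_] //=.
- have lin z : U z -> 'd f z (a *: u + b *: w) = a * 'd f z u + b * 'd f z w.
    by move=> _; rewrite linearD !linearZ.
  rewrite (Dd_lin (a *: u + b *: w) Uo (dfu _) (dfu u) (dfu w) lin Uy).
  rewrite cuE cwE [RHS]big_ord_recl /=.
  under [X in _ = _ + X]eq_bigr => i _ do rewrite mulrDl.
  rewrite big_split /= addrA; congr (_ + _).
    rewrite big_ord_recl /= big_ord_recr /= ltnn mul0r addr0 mulrDr mulr_sumr.
    congr (_ + _); first by rewrite !subn0 expr0 !mulr1 exprS mulrCA.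
    apply: eq_bigr => i _; rewrite /bump /= !add1n ltn_ord.
    by rewrite subSS -(subnSK (ltn_ord i)) (exprS a); ring.
  rewrite mulr_sumr; apply: eq_bigr => i _.
  by rewrite /bump /= add1n subSS exprS; ring.
(* The coefficient of index [1] gets one term with [w] taken first and [k] terms with [u] taken
   first; symmetry of second derivatives makes these all equal. *)
- rewrite cw0; clear -cu1 dfu df Uo Uy; case: k dfu cu1 => [|k] dfu cu1.
    by rewrite ltnn add0r mul1r.
  rewrite cu1 //= [X in _ + X = _]/= -[k.+2]addn1 natrD mulrDl mul1r; congr (_ * _ + _).
  apply: (@Dd_congr k U) => //; [exact: (dfu u).2 | exact: (dfu w).2 |].
  move=> z Uz; apply: (diff_diffC Uo Uz df); [exact: (dfu u).1 | exact: (dfu w).1].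
Qed.

End DirectionalDerivatives.

(** * Taylor's formula along a segment *)

(** Both [g - P + Q] and [P + Q - g] vanish at [0] and have nonnegative derivative. This replaces
    integration of the remainder. *)
Lemma poly_approx_of_deriv (R : realType) (g g' : R -> R) (P Q : {poly R}) (s : R) : 0 <= s ->
  (forall t, t \in `[0, s] -> is_derive t 1 g (g' t)) ->
  (forall t, t \in `[0, s] -> `|g' t - P^`().[t]| <= Q^`().[t]) ->
  g 0 = P.[0] -> Q.[0] = 0 -> `|g s - P.[s]| <= Q.[s].
Proof.
move=> s0 dg bnd g0 Q0.
have nonneg (P1 : {poly R}) (c : R) :
    (forall t, t \in `[0, s] -> 0 <= c * g' t + P1^`().[t]) ->
    c * g 0 + P1.[0] <= c * g s + P1.[s].
  move=> H; pose psi := (c *: g) + horner P1.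
  have dpsi t : t \in `[0, s] -> is_derive t 1 psi (c * g' t + P1^`().[t]).
    by move=> ts; apply: is_deriveD; apply: is_deriveZ; exact: dg.
  have dpsio t : t \in `]0, s[ -> is_derive t 1 psi (c * g' t + P1^`().[t]).
    by move=> /subset_itv_oo_cc; exact: dpsi.
  have psic : {within `[0, s], continuous psi}.
    by apply: derivable_within_continuous => t /dpsi ?; exact: ex_derive.
  have [xi xis psiE] := MVT_segment s0 dpsio psic.
  by rewrite -subr_ge0 -[leRHS]/(psi s - psi 0) psiE subr0 mulr_ge0 ?H.
have lo : 1 * g 0 + (Q - P).[0] <= 1 * g s + (Q - P).[s].
  apply: nonneg => t ts; rewrite derivB hornerD hornerN.
  by have := bnd _ ts; rewrite ler_norml => /andP[]; lra.
have up : -1 * g 0 + (P + Q).[0] <= -1 * g s + (P + Q).[s].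
  apply: nonneg => t ts; rewrite derivD hornerD.
  by have := bnd _ ts; rewrite ler_norml => /andP[]; lra.
rewrite !(hornerD, hornerN) Q0 g0 in lo up.
by rewrite ler_norml; apply/andP; split; lra.
Qed.

(** Induction on the order: the estimate for ['d f y u] bounds the derivative along the segment, and
    [poly_approx_of_deriv] raises the order by one. *)
Lemma taylor_line (R : realType) (n k : nat) (U : set 'rV[R]_n) (f : 'rV[R]_n -> R)
    (x u : 'rV[R]_n) (C : R) : open U -> diffn k U f ->
  (forall s, 0 <= s <= 1 -> U (x + s *: u)) ->
  (forall s, 0 <= s <= 1 -> `|Dd k u f (x + s *: u) - Dd k u f x| <= C * s) ->
  forall s, 0 <= s <= 1 ->
    `|f (x + s *: u) - \sum_(j < k.+1) s ^+ j / j`!%:R * Dd j u f x|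
      <= C * s ^+ k.+1 / k.+1`!%:R.
Proof.
move=> Uo; elim: k f => [|k IH] f dkf Us DL s s01.
  by rewrite big_ord1 /= expr0 fact0 divr1 mul1r expr1 divr1; exact: DL.
have [df dfu] := dkf.
have {}IH := IH _ (dfu u) Us DL.
pose P : {poly R} := \poly_(j < k.+2) (Dd j u f x / j`!%:R).
pose Q : {poly R} := (C / k.+2`!%:R) *: 'X^(k.+2).
have factSR j : (j.+1`!%:R : R) = j.+1%:R * j`!%:R by rewrite factS natrM.
have fact_neq0 j : (j`!%:R : R) != 0 by rewrite pnatr_eq0 -lt0n fact_gt0.
have PE t : P.[t] = \sum_(j < k.+2) t ^+ j / j`!%:R * Dd j u f x.
  by rewrite horner_poly; apply: eq_bigr => j _; rewrite mulrC mulrA mulrAC.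
have dPE t : P^`().[t] = \sum_(j < k.+1) t ^+ j / j`!%:R * Dd j u (fun y => 'd f y u) x.
  have sz : (size P^`() <= k.+1)%N.
    have [->|P0] := eqVneq P 0; first by rewrite deriv0 size_poly0.
    by rewrite -ltnS (leq_trans (lt_size_deriv P0)) // size_poly.
  rewrite (horner_coef_wide _ sz); apply: eq_bigr => j _.
  rewrite coef_deriv coef_poly ltnS ltn_ord /= factSR -mulr_natr.
  by move: (Dd j u _ x) => D; field; rewrite fact_neq0 /= ?nat1r -?natrD pnatr_eq0.
have QE t : Q.[t] = C * t ^+ k.+2 / k.+2`!%:R by rewrite hornerZ hornerXn mulrAC.
have dQE t : Q^`().[t] = C * t ^+ k.+1 / k.+1`!%:R.
  rewrite derivZ derivXn /= hornerZ hornerMn hornerXn -[X in _ * X = _]mulr_natr factSR.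
  have : k.+2%:R != 0 :> R by rewrite pnatr_eq0.
  move: (k.+2%:R : R) (t ^+ k.+1) => r T r0.
  by field; rewrite r0 fact_neq0.
rewrite -PE -QE; have /andP[s0 s1] := s01.
have t01 t : t \in `[0, s] -> 0 <= t <= 1.
  by rewrite in_itv /= => /andP[-> /le_trans]; exact.
apply: (@poly_approx_of_deriv R (fun t => f (x + t *: u)) (fun t => 'd f (x + t *: u) u)) => //.
- by move=> t /t01 ts; apply: is_derive_line; exact/df/Us.
- by move=> t /t01 ts; rewrite dPE dQE; exact: IH.
- rewrite PE big_ord_recl big1 => [|i _]; last by rewrite exprS !mul0r.
  by rewrite scale0r !addr0 expr0 fact0 divr1 mul1r.
- by rewrite QE exprS mul0r mulr0 mul0r.
Qed.

(** * The Euclidean structure defined by B *)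

Section InnerProduct.
Variables (R : realType) (n : nat) (B : 'M[R]_n).
Notation E := 'rV[R]_n.
Implicit Types (u v w x y z : E) (a b : R).

Definition bform u w : R := \sum_(i < n) \sum_(j < n) u 0 i * B i j * w 0 j.

Lemma bformE u w : bform u w = (u *m B *m w^T) 0 0.
Proof.
rewrite !mxE /bform exchange_big /=; apply: eq_bigr => j _.
by rewrite !mxE mulr_suml.
Qed.

Lemma bformDl u v w : bform (u + v) w = bform u w + bform v w.
Proof. by rewrite !bformE !mulmxDl mxE. Qed.

Lemma bformDr u v w : bform w (u + v) = bform w u + bform w v.
Proof. by rewrite !bformE linearD mulmxDr mxE. Qed.

Lemma bformZl a u w : bform (a *: u) w = a * bform u w.
Proof. by rewrite !bformE -!scalemxAl mxE. Qed.

Lemma bformZr a u w : bform u (a *: w) = a * bform u w.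
Proof. by rewrite !bformE linearZ -scalemxAr mxE. Qed.

Lemma bformNl u w : bform (- u) w = - bform u w.
Proof. by rewrite -scaleN1r bformZl mulN1r. Qed.

Lemma bformNr u w : bform u (- w) = - bform u w.
Proof. by rewrite -scaleN1r bformZr mulN1r. Qed.

Lemma bform0r u : bform u 0 = 0.
Proof. by rewrite -(scale0r 0) bformZr mul0r. Qed.

Lemma dualp_bform u w : dualp (u *m B) w = bform u w.
Proof.
by rewrite /dualp bformE !mxE; apply: eq_bigr => i _; rewrite !mxE.
Qed.

Hypothesis B_spd : spd B.

Lemma bformC u w : bform u w = bform w u.
Proof.
have [BT _] := B_spd.
rewrite /bform exchange_big /=; apply: eq_bigr => i _; apply: eq_bigr => j _.
have -> : B j i = B i j by rewrite -[in LHS]BT mxE.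
by rewrite mulrC mulrA mulrAC.
Qed.

Lemma bform_ge0 u : 0 <= bform u u.
Proof.
have [_ Bp] := B_spd.
have [->|u0] := eqVneq u 0; first by rewrite bform0r.
exact/ltW/Bp.
Qed.

Lemma Bnorm_ge0 u : 0 <= Bnorm B u.
Proof. exact: sqrtr_ge0. Qed.

Lemma sqr_Bnorm u : Bnorm B u ^+ 2 = bform u u.
Proof. by rewrite sqr_sqrtr ?bform_ge0. Qed.

Lemma Bnorm_eq0 u : (Bnorm B u == 0) = (u == 0).
Proof.
apply/idP/eqP => [|->]; last by rewrite -sqrf_eq0 sqr_Bnorm bform0r.
rewrite -sqrf_eq0 sqr_Bnorm; apply: contraTeq => u0.
by rewrite gt_eqF //; have [_] := B_spd; exact.
Qed.

Lemma BnormZ a u : Bnorm B (a *: u) = `|a| * Bnorm B u.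
Proof.
rewrite /Bnorm -/(bform _ _) -/(bform _ _) bformZl bformZr mulrA -expr2.
by rewrite sqrtrM ?sqr_ge0 // sqrtr_sqr.
Qed.

Lemma BnormN u : Bnorm B (- u) = Bnorm B u.
Proof. by rewrite -scaleN1r BnormZ normrN1 mul1r. Qed.

Lemma sqr_BnormD u w :
  Bnorm B (u + w) ^+ 2 = Bnorm B u ^+ 2 + 2 * bform u w + Bnorm B w ^+ 2.
Proof. by rewrite !sqr_Bnorm bformDl !bformDr (bformC w u); ring. Qed.

Lemma bform_le u w : bform u w <= Bnorm B u * Bnorm B w.
Proof.
have [/eqP|u0] := eqVneq (Bnorm B u) 0.
  by rewrite Bnorm_eq0 => /eqP ->; rewrite bformC bform0r mulr_ge0 ?Bnorm_ge0.
have [/eqP|w0] := eqVneq (Bnorm B w) 0.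
  by rewrite Bnorm_eq0 => /eqP ->; rewrite bform0r mulr_ge0 ?Bnorm_ge0.
set p := Bnorm B u in u0 *; set q := Bnorm B w in w0 *.
have p0 : 0 < p by rewrite lt0r u0 Bnorm_ge0.
have q0 : 0 < q by rewrite lt0r w0 Bnorm_ge0.
have := bform_ge0 (q *: u - p *: w).
rewrite -sqr_Bnorm sqr_BnormD BnormN !BnormZ bformNr bformZl bformZr !gtr0_norm //.
rewrite -/p -/q => h.
rewrite -(ler_pM2l (mulr_gt0 p0 q0)).
clearbody p q; move: (bform u w) h => c h; lra.
Qed.

Lemma bform_norm_le u w : `|bform u w| <= Bnorm B u * Bnorm B w.
Proof.
by rewrite ler_norml lerNl -bformNl -(BnormN u) bform_le BnormN bform_le.
Qed.

Lemma BnormD u w : Bnorm B (u + w) <= Bnorm B u + Bnorm B w.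
Proof.
rewrite -(ler_pXn2r (ltn0Sn 1)) ?nnegrE ?addr_ge0 ?Bnorm_ge0 //.
rewrite sqr_BnormD; have := bform_le u w; lra.
Qed.

Lemma spd_unitmx : B \in unitmx.
Proof.
rewrite -row_free_unit -kermx_eq0; apply/rowV0P => v /sub_kermxP vB.
by apply/eqP; rewrite -Bnorm_eq0 -sqrf_eq0 sqr_Bnorm bformE vB mul0mx mxE.
Qed.

(** Covectors are represented by vectors through [B]; the dual norm of a covector is then the
    [Bnorm] of its representative. *)
Lemma bform_riesz (l : E -> R) : scalar l -> exists u, forall w, l w = bform u w.
Proof.
move=> l_lin; pose g : E := \row_i l (delta_mx 0 i).
exists (g *m invmx B) => w.
rewrite -dualp_bform mulmxKV ?spd_unitmx //.
pose lL := GRing.isLinear.Build _ _ _ _ l l_lin.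
pose L : {linear E -> R | *%R} := HB.pack l lL.
rewrite -[l w]/(L w) {1}[w]row_sum_delta linear_sum /dualp.
by apply: eq_bigr => i _; rewrite linearZ /= mxE mulrC.
Qed.

(** Coordinates are linear forms, hence bounded by Cauchy-Schwarz after Riesz representation. This
    links [Bnorm] to the topology, which comes from the sup norm. *)
Lemma mx_norm_le_Bnorm : exists2 M : R, 0 < M & forall u : E, `|u| <= M * Bnorm B u.
Proof.
have /choice[g gE] i : exists v, forall w : E, w 0 i = bform v w.
  by apply: bform_riesz => a u w; rewrite !mxE.
exists (1 + \sum_(i < n) Bnorm B (g i)).
  by rewrite ltr_pwDl ?sumr_ge0 // => i _; exact: Bnorm_ge0.
move=> u; rewrite [`|u|]mx_normrE.
apply: bigmax_le => [|[i0 i] _].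
  by rewrite mulr_ge0 ?Bnorm_ge0 // addr_ge0 ?sumr_ge0 // => i _; exact: Bnorm_ge0.
rewrite [i0]ord1 /= gE (le_trans (bform_norm_le _ _)) // ler_wpM2r ?Bnorm_ge0 //.
rewrite (bigD1 i) //= addrCA lerDl addr_ge0 ?sumr_ge0 // => j _.
exact: Bnorm_ge0.
Qed.

End InnerProduct.
(** * Subgradient at a tensor step *)

(** Gram-Schmidt on [u] and [w]. When they are dependent, [e1] or [e2] may be zero, hence an
    inequality rather than an isometry in the last clause. *)
Lemma plane_coordinates (R : realType) (n : nat) (B : 'M[R]_n) (u w : 'rV[R]_n) :
  spd B ->
  exists e1 e2 : 'rV[R]_n, exists2 ab : R * R, ab.1 ^+ 2 + ab.2 ^+ 2 = 1 &
    [/\ u = Bnorm B u *: e1, w = Bnorm B w *: (ab.1 *: e1 + ab.2 *: e2) &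
     forall a b, a ^+ 2 + b ^+ 2 = 1 -> Bnorm B (a *: e1 + b *: e2) <= 1].
Proof.
move=> B_spd.
(* The inverse of [0] is [0], so [unit 0 = 0] and [unitE] holds for every vector. *)
pose unit v := (Bnorm B v)^-1 *: v.
have unitE v : v = Bnorm B v *: unit v.
  rewrite /unit scalerA; have [/eqP|v0] := eqVneq (Bnorm B v) 0; last by rewrite divff ?scale1r.
  by rewrite (Bnorm_eq0 B_spd) => /eqP ->; rewrite scaler0.
have unit_le1 v : Bnorm B (unit v) <= 1.
  rewrite BnormZ // normfV (ger0_norm (Bnorm_ge0 _ _)).
  have [->|v0] := eqVneq (Bnorm B v) 0; first by rewrite mulr0.
  by rewrite mulVf.
have Bnorm0 : Bnorm B 0 = 0 by apply/eqP; rewrite Bnorm_eq0.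
have [u0|u0] := eqVneq u 0.
  exists (unit w), 0, (1, 0); first by rewrite /= expr1n expr0n addr0.
  split=> [||a b ab] /=; first by rewrite u0 Bnorm0 scale0r.
    by rewrite scale1r scaler0 addr0 -unitE.
  rewrite scaler0 addr0 BnormZ // mulr_ile1 ?normr_ge0 ?Bnorm_ge0 //.
  by rewrite -(ler_pXn2r (ltn0Sn 1)) ?nnegrE // real_normK ?num_real // expr1n -ab lerDl sqr_ge0.
set e1 := unit u.
have e11 : bform B e1 e1 = 1.
  by rewrite bformZl bformZr -sqr_Bnorm //; field; rewrite Bnorm_eq0.
pose w0 := w - bform B w e1 *: e1.
have w0e1 : bform B e1 w0 = 0.
  by rewrite bformDr bformNr bformZr e11 mulr1 bformC // subrr.
have e12 : bform B e1 (unit w0) = 0 by rewrite bformZr w0e1 mulr0.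
have wE : w = bform B w e1 *: e1 + Bnorm B w0 *: unit w0.
  by rewrite -unitE /w0 addrC subrK.
have wN : Bnorm B w ^+ 2 = bform B w e1 ^+ 2 + Bnorm B w0 ^+ 2.
  rewrite {1}wE -unitE sqr_BnormD // bformZl w0e1 !mulr0 addr0 BnormZ // exprMn.
  by rewrite real_normK ?num_real // (sqr_Bnorm B_spd e1) e11 mulr1.
have le1 a b : a ^+ 2 + b ^+ 2 = 1 -> Bnorm B (a *: e1 + b *: unit w0) <= 1.
  move=> ab; rewrite -(ler_pXn2r (ltn0Sn 1)) ?nnegrE ?Bnorm_ge0 // expr1n.
  rewrite sqr_BnormD // bformZl bformZr e12 !mulr0 addr0 (BnormZ _ a e1) (BnormZ _ b (unit w0)) !exprMn.
  rewrite !real_normK ?num_real // (sqr_Bnorm B_spd e1) e11 mulr1 -ab lerD2l.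
  by rewrite ler_piMr ?sqr_ge0 // exprn_ile1 ?Bnorm_ge0.
have [ws|ws] := eqVneq (Bnorm B w) 0.
  exists e1, (unit w0), (1, 0); first by rewrite /= expr1n expr0n addr0.
  split; [exact: (unitE u) | | exact: le1].
  by rewrite ws scale0r; apply/eqP; rewrite -(Bnorm_eq0 B_spd) ws.
exists e1, (unit w0), (bform B w e1 / Bnorm B w, Bnorm B w0 / Bnorm B w) => /=.
  by rewrite !exprMn -mulrDl -wN -exprMn divff // expr1n.
split; [exact: (unitE u) | | exact: le1].
by rewrite [RHS]scalerDr (scalerA _ _ e1) (scalerA _ _ (unit w0)) ![Bnorm B w * _]mulrC !divfK.
Qed.

Lemma Dd_scale (R : realType) (n k : nat) (U : set 'rV[R]_n) (f : 'rV[R]_n -> R)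
    (a : R) (u y : 'rV[R]_n) :
  open U -> diffn k U f -> U y -> Dd k (a *: u) f y = a ^+ k * Dd k u f y.
Proof.
move=> Uo df Uy; have [c cP] := Dd_binary_form u 0 Uo df.
have [cE c0 _] := cP _ Uy.
have := cE a 0; rewrite scaler0 addr0 => ->.
rewrite big_ord_recl big1 => [|i _]; last by rewrite exprS mul0r !mulr0.
by rewrite subn0 expr0 mulr1 addr0 c0 mulrC.
Qed.

Lemma Dd_diff_lin (R : realType) (n k : nat) (U : set 'rV[R]_n) (f : 'rV[R]_n -> R)
    (a b : R) (u v w y : 'rV[R]_n) : open U -> diffn k.+1 U f -> U y ->
  Dd k u (fun z => 'd f z (a *: v + b *: w)) y =
    a * Dd k u (fun z => 'd f z v) y + b * Dd k u (fun z => 'd f z w) y.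
Proof.
move=> Uo [df dfu] Uy.
have lin z : U z -> 'd f z (a *: v + b *: w) = a * 'd f z v + b * 'd f z w.
  by move=> _; rewrite linearD !linearZ.
exact: (Dd_lin u Uo (dfu _) (dfu v) (dfu w) lin Uy).
Qed.

(* For a symmetric [p]-linear form over a Euclidean norm, the bound on the
   diagonal also bounds all values with one argument changed (Banach). *)
Lemma Dd_mixed_bound (R : realType) (n k : nat) (B : 'M[R]_n) (U : set 'rV[R]_n)
    (f : 'rV[R]_n -> R) (y z : 'rV[R]_n) (M : R) :
  spd B -> open U -> diffn k.+1 U f -> U y -> U z ->
  (forall u, Bnorm B u <= 1 -> `|Dd k.+1 u f y - Dd k.+1 u f z| <= M) ->
  forall u w, `|Dd k u (fun x => 'd f x w) y - Dd k u (fun x => 'd f x w) z|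
    <= M * Bnorm B u ^+ k * Bnorm B w.
Proof.
move=> B_spd Uo df Uy Uz DM u w.
have [e1 [e2 [[al be] /= ab1 [uE wE ab_le1]]]] := plane_coordinates u w B_spd.
have [c cP] := Dd_binary_form e1 e2 Uo df.
have [cyE cy0 /(_ isT) cy1] := cP _ Uy; have [czE cz0 /(_ isT) cz1] := cP _ Uz.
(* In the plane of [e1] and [e2] the difference of the two derivatives is one binary form, bounded
   by [M] on the circle. *)
have cM a b : a ^+ 2 + b ^+ 2 = 1 ->
    `|\sum_(m < k.+2) (c m y - c m z) * (a ^+ (k.+1 - m) * b ^+ m)| <= M.
  move=> /ab_le1 /DM; rewrite cyE czE -sumrB.
  by under [X in _ -> `|X| <= M]eq_bigr => m _ do rewrite mulrBl.
(* Both leading coefficients carry the factor [k.+1] in [bernstein_szego], which cancels against the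
   one on the right: no constant is lost. *)
have key : `|(Dd k.+1 e1 f y - Dd k.+1 e1 f z) * al
    + (Dd k e1 (fun x => 'd f x e2) y - Dd k e1 (fun x => 'd f x e2) z) * be| <= M.
  by have := @bernstein_szego R k.+1 (fun m => c m y - c m z) M (ltn0Sn k) cM al be ab1;
    rewrite cy0 cz0 cy1 cz1 -mulrBr -!mulrA -mulrDr normrM normr_nat ler_pM2l //.
have expand v : U v -> Dd k u (fun x => 'd f x w) v = Bnorm B u ^+ k * (Bnorm B w *
    (Dd k.+1 e1 f v * al + Dd k e1 (fun x => 'd f x e2) v * be)).
  move=> Uv; rewrite [in LHS]uE [in LHS]wE.
  have [_ dfu] := df.
  rewrite (Dd_scale _ _ Uo (dfu _) Uv); congr (_ * _).
  rewrite scalerDr !scalerA (Dd_diff_lin _ _ _ _ _ Uo df Uv) mulrDr.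
  by rewrite -!mulrA !(mulrC al) !(mulrC be).
rewrite (expand _ Uy) (expand _ Uz) -!mulrBr !normrM.
rewrite normrX (ger0_norm (Bnorm_ge0 B u)) (ger0_norm (Bnorm_ge0 B w)).
rewrite mulrA [leLHS]mulrC -[leRHS]mulrA ler_wpM2r ?mulr_ge0 ?exprn_ge0 ?Bnorm_ge0 //.
by rewrite !mulrBl addrACA -opprD in key.
Qed.
(** Taylor's formula for [z => 'd f z w] on the segment from [x] to [y]; [Dd_mixed_bound] supplies
    the Lipschitz constant of its derivative of order [k]. *)
Lemma gradient_taylor_bound (R : realType) (n k : nat) (B : 'M[R]_n) (U D : set 'rV[R]_n)
    (f : 'rV[R]_n -> R) (L : R) (x y w : 'rV[R]_n) :
  spd B -> open U -> diffn k.+1 U f -> D `<=` U -> convex_set_on D ->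
  (forall y z u, D y -> D z -> Bnorm B u <= 1 ->
     `|Dd k.+1 u f y - Dd k.+1 u f z| <= L * Bnorm B (y - z)) ->
  D x -> D y ->
  `|'d f y w - \sum_(j < k.+1) (j`!%:R)^-1 * Dd j (y - x) (fun z => 'd f z w) x|
    <= L / k.+1`!%:R * Bnorm B (y - x) ^+ k.+1 * Bnorm B w.
Proof.
move=> B_spd Uo df DU Dc fL Dx Dy.
have Ds s : 0 <= s <= 1 -> D (x + s *: (y - x)).
  move=> s01; have := Dc _ _ _ Dy Dx s01.
  by congr D; rewrite scalerBr scalerBl scale1r addrCA.
have [_ dfu] := df.
pose C := L * Bnorm B (y - x) ^+ k.+1 * Bnorm B w.
have bound s : 0 <= s <= 1 ->
    `|Dd k (y - x) (fun z => 'd f z w) (x + s *: (y - x)) -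
      Dd k (y - x) (fun z => 'd f z w) x| <= C * s.
  move=> s01.
  have fLs u : Bnorm B u <= 1 ->
      `|Dd k.+1 u f (x + s *: (y - x)) - Dd k.+1 u f x| <= L * (s * Bnorm B (y - x)).
    move=> u1; apply: le_trans (fL _ _ _ (Ds _ s01) Dx u1) _.
    by rewrite addrAC subrr add0r BnormZ ger0_norm //; case/andP: s01.
  apply: le_trans (Dd_mixed_bound B_spd Uo df (DU _ (Ds _ s01)) (DU _ Dx) fLs _ _) _.
  by rewrite [leLHS](_ : _ = C * s) // /C exprS; ring.
have one01 : (0 : R) <= 1 <= (1 : R) by rewrite ler01 lexx.
have := taylor_line Uo (dfu w) (fun s s01 => DU _ (Ds s s01)) bound one01.
have -> : x + 1 *: (y - x) = y by rewrite scale1r addrC subrK.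
rewrite (expr1n R k.+1) (mulr1 C) => h.
rewrite [leRHS](_ : _ = C / k.+1`!%:R); last by rewrite /C; ring.
apply: le_trans h; rewrite le_eqVlt; apply/orP; left; apply/eqP.
by congr (`|_ - _|); apply: eq_bigr => j _; rewrite expr1n mul1r.
Qed.

(** * One-sided slopes through polynomial majorants *)

Section PolynomialMajorant.
Variable R : realType.
Implicit Types (phi : R -> R) (P : {poly R}).

(** A polynomial touching [phi] from above at [0] with slope [l]. This bounds the right slope of
    [phi] and is stable under sums and nonnegative multiples, which suits minimality conditions
    involving powers of a norm. *)
Definition poly_majorant phi (l : R) :=
  exists P, [/\ forall t, 0 <= t -> phi t <= P.[t], P.[0] = phi 0 & P^`().[0] = l].

Lemma poly_majorantD phi psi l m : poly_majorant phi l -> poly_majorant psi m ->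
  poly_majorant (fun t => phi t + psi t) (l + m).
Proof.
move=> [P [P1 P2 P3]] [Q [Q1 Q2 Q3]]; exists (P + Q).
split=> [t t0||]; rewrite ?derivD hornerD ?P2 ?P3 ?Q2 ?Q3 //.
by rewrite lerD ?P1 ?Q1.
Qed.

Lemma poly_majorantZ (a : R) phi l : 0 <= a -> poly_majorant phi l ->
  poly_majorant (fun t => a * phi t) (a * l).
Proof.
move=> a0 [P [P1 P2 P3]]; exists (a *: P).
split=> [t t0||]; rewrite ?derivZ hornerZ ?P2 ?P3 //.
by rewrite ler_wpM2l ?P1.
Qed.

Lemma poly_majorant_poly P : poly_majorant (horner P) P^`().[0].
Proof. by exists P. Qed.

Lemma poly_majorant_sum (I : Type) (r : seq I) (phi : I -> R -> R) (l : I -> R) :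
  (forall i, poly_majorant (phi i) (l i)) ->
  poly_majorant (fun t => \sum_(i <- r) phi i t) (\sum_(i <- r) l i).
Proof.
move=> H; elim: r => [|i r IH].
  exists 0; split=> [t _||]; by rewrite ?deriv0 horner0 big_nil.
have -> : (fun t => \sum_(j <- i :: r) phi j t) = (fun t => phi i t + \sum_(j <- r) phi j t).
  by apply/funext => t; rewrite big_cons.
by rewrite big_cons; exact: poly_majorantD.
Qed.

(** Write [P] as [P.[0] + t * l + t ^+ 2 * S.[t]] with [S] bounded on the unit interval, divide by
    [t] and let [t] tend to [0]. *)
Lemma poly_majorant_slope phi l c : poly_majorant phi l ->
  (forall t, 0 < t <= 1 -> t * c <= phi t - phi 0) -> c <= l.
Proof.
move=> [P [Pmaj P0 P'0]] H.
have divX (Q : {poly R}) : exists S : {poly R}, Q = Q.[0]%:P + S * 'X.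
  have /factor_theorem[S SE] : root (Q - Q.[0]%:P) 0.
    by rewrite /root !hornerE subrr.
  by exists S; rewrite -[X in S * X]subr0 -polyC0 -SE addrC subrK.
have [Q PX] := divX P; have [S QX] := divX Q.
have Q0 : Q.[0] = l.
  by rewrite -P'0 PX derivD derivC derivM derivX !hornerE.
have QE t : P.[t] = P.[0] + t * Q.[t] by rewrite {1}PX !hornerE mulrC.
have SE t : Q.[t] = Q.[0] + t * S.[t] by rewrite {1}QX !hornerE mulrC.
pose K := \sum_(i < size S) `|S`_i|.
have SK t : 0 < t <= 1 -> S.[t] <= K.
  move=> /andP[t0 t1]; rewrite horner_coef; apply: ler_sum => i _.
  rewrite (le_trans (ler_norm _)) // normrM ler_piMr // normrX.
  by rewrite exprn_ile1 // ger0_norm // ltW.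
have K0 : 0 <= K by apply: sumr_ge0.
apply/ler_addgt0Pr => e e0.
pose t := Num.min 1 (e / (K + 1)).
have K1 : 0 < K + 1 by rewrite ltr_wpDl.
have t0 : 0 < t by rewrite lt_min ltr01 divr_gt0.
have t1 : t <= 1 by rewrite ge_min lexx.
have t01 : 0 < t <= 1 by rewrite t0.
have tK : t * (K + 1) <= e by rewrite -ler_pdivlMr // ge_min lexx orbT.
have := le_trans (H t t01) (lerB (Pmaj t (ltW t0)) (lexx _)).
rewrite -P0 QE addrAC subrr add0r ler_pM2l // SE Q0 => h.
have := ler_wpM2l (ltW t0) (SK t t01).
lra.
Qed.
End PolynomialMajorant.

(** For [u != 0] and [r = Bnorm B u], the arithmetic-geometric inequality gives [|u + t w| <= (r ^+
    2 + |u + t w| ^+ 2) / (2 r)]. The right side is the quadratic polynomial [N] with value [r] and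
    slope [b / r] at [0]; its power is the majorant. *)
Lemma poly_majorant_Bnorm (R : realType) (n m : nat) (B : 'M[R]_n) (u w : 'rV[R]_n) :
  spd B -> poly_majorant (fun t => Bnorm B (u + t *: w) ^+ m.+2)
    (m.+2%:R * Bnorm B u ^+ m * bform B u w).
Proof.
move=> B_spd.
have [u0|u0] := eqVneq u 0.
  exists ((Bnorm B w ^+ m.+2) *: 'X^(m.+2)); rewrite u0.
  have B0 : Bnorm B 0 = 0 by apply/eqP; rewrite Bnorm_eq0.
  split=> [t t0||].
  - by rewrite hornerZ hornerXn add0r BnormZ ger0_norm // exprMn mulrC.
  - by rewrite hornerZ hornerXn scale0r addr0 B0 !exprS !mul0r mulr0.
  - rewrite derivZ derivXn hornerZ hornerMn hornerXn /= [0 ^+ _]exprS mul0r mul0rn mulr0.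
    by rewrite bformC // bform0r mulr0.
set r := Bnorm B u.
have r0 : 0 < r by rewrite lt0r Bnorm_eq0 // u0 Bnorm_ge0.
pose b := bform B u w; pose c := Bnorm B w ^+ 2.
pose N : {poly R} := r%:P + (b / r) *: 'X + (c / (2 * r)) *: 'X^2.
have NE t : N.[t] = r + (b / r) * t + (c / (2 * r)) * t ^+ 2 by rewrite !hornerE.
exists (N ^+ m.+2); split=> [t t0||].
- rewrite horner_exp.
  have sq : Bnorm B (u + t *: w) ^+ 2 = r ^+ 2 + 2 * (t * b) + t ^+ 2 * c.
    by rewrite sqr_BnormD // bformZr BnormZ exprMn real_normK ?num_real.
  have rN : 2 * r * N.[t] = r ^+ 2 + Bnorm B (u + t *: w) ^+ 2.
    by rewrite sq NE; clearbody r b c; field; rewrite gt_eqF.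
  have N0 : 0 <= N.[t].
    by rewrite -(pmulr_rge0 _ (mulr_gt0 (ltr0n R 2) r0)) rN addr_ge0 ?sqr_ge0.
  rewrite lerXn2r ?nnegrE ?Bnorm_ge0 //.
  rewrite -(ler_pM2l (mulr_gt0 (ltr0n R 2) r0)) rN.
  have := sqr_ge0 (r - Bnorm B (u + t *: w)); move: (Bnorm B _) => v.
  clearbody r; lra.
- by rewrite horner_exp NE !(mulr0, expr0n, addr0) scale0r addr0.
- rewrite deriv_exp hornerMn hornerM horner_exp NE !(mulr0, expr0n, addr0) /=.
  rewrite /N !derivD derivC !derivZ derivX derivXn !hornerE /=.
  rewrite -mulr_natr exprS -/b -/r; field; by rewrite gt_eqF.
Qed.
(** Each term is a polynomial in [t] by [Dd_binary_form]. The slopes of the terms add up to the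
    Taylor polynomial of the gradient, tested on [w]. *)
Lemma poly_majorant_taylor (R : realType) (n p : nat) (U : set 'rV[R]_n)
    (f : 'rV[R]_n -> R) (x y w : 'rV[R]_n) :
  open U -> diffn p U f -> U x ->
  poly_majorant (fun t => taylor p f x (y + t *: w))
    (\sum_(1 <= k < p.+1) (k.-1`!%:R)^-1 * Dd k.-1 (y - x) (fun z => 'd f z w) x).
Proof.
move=> Uo df Ux.
have -> : (fun t => taylor p f x (y + t *: w)) = (fun t => (f x)%:P.[t] +
    \sum_(1 <= k < p.+1) (k`!%:R)^-1 * Dd k ((y - x) + t *: w) f x).
  by apply/funext => t; rewrite hornerC /taylor addrAC.
rewrite -[l in poly_majorant _ l]add0r; apply: poly_majorantD.
  by have := poly_majorant_poly (f x)%:P; rewrite derivC horner0.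
(* The range is moved into the summand, as [poly_majorant_sum] asks for a majorant at every
   index. *)
have -> : (fun t => \sum_(1 <= k < p.+1) (k`!%:R)^-1 * Dd k (y - x + t *: w) f x)
  = (fun t => \sum_(1 <= k < p.+1) (if (0 < k < p.+1)%N then (k`!%:R)^-1 * Dd k (y - x + t *: w) f x else 0)).
  by apply/funext => t; rewrite big_nat big_mkcond.
rewrite [l in poly_majorant _ l]big_nat [l in poly_majorant _ l]big_mkcond.
apply: poly_majorant_sum => -[|k] /=.
  by have := poly_majorant_poly (0 : {poly R}); rewrite deriv0 horner0 horner0_ext.
rewrite ltnS; case: ifP => kp; last first.
  by have := poly_majorant_poly (0 : {poly R}); rewrite deriv0 horner0 horner0_ext.
have dk : diffn k.+1 U f := diffn_leq kp df.
have [c cP] := Dd_binary_form (y - x) w Uo dk.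
have [cE c0 /(_ isT) c1] := cP _ Ux.
pose P : {poly R} := \poly_(m < k.+2) c m x.
have PE t : Dd k.+1 (y - x + t *: w) f x = P.[t].
  have := cE 1 t; rewrite scale1r => ->.
  by rewrite horner_poly; apply: eq_bigr => m _; rewrite expr1n mul1r.
have -> : (fun t => (k.+1`!%:R)^-1 * Dd k.+1 (y - x + t *: w) f x) =
  (fun t => (k.+1`!%:R)^-1 * P.[t]) by apply/funext => t; rewrite PE.
have P'0 : P^`().[0] = k.+1%:R * Dd k (y - x) (fun z => 'd f z w) x.
  by rewrite horner_coef0 coef_deriv coef_poly /= c1 mulr1n.
have -> : (k`!%:R)^-1 * Dd k (y - x) (fun z => 'd f z w) x = (k.+1`!%:R)^-1 * P^`().[0].
  by rewrite P'0 factS natrM invfM mulrACA mulVf ?mul1r // pnatr_eq0.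
by apply: poly_majorantZ; [rewrite invr_ge0|exact: poly_majorant_poly].
Qed.

Lemma convex_diff_le (R : realType) (n : nat) (U : set 'rV[R]_n)
    (f : 'rV[R]_n -> R) (x y : 'rV[R]_n) :
  convex_on U f -> U x -> U y -> differentiable f x -> 'd f x (y - x) <= f y - f x.
Proof.
move=> fc Ux Uy df; set w := y - x.
apply/ler_addgt0Pr => e e0.
have w1 : 0 < `|w| + 1 by rewrite ltr_wpDl.
have [d d0 dE] := diff_approx df (divr_gt0 e0 w1).
pose t := Num.min 1 (d / 2 / (`|w| + 1)).
have t0 : 0 < t by rewrite lt_min ltr01 !divr_gt0.
have t1 : t <= 1 by rewrite ge_min lexx.
have td : t * `|w| < d.
  have : t * (`|w| + 1) <= d / 2 by rewrite -ler_pdivlMr // ge_min lexx orbT.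
  lra.
have := dE (t *: w); rewrite normrZ gtr0_norm // => /(_ td).
have -> : 'd f x (t *: w) = t * 'd f x w by rewrite linearZ.
move=> /ler_normlP[h _].
have t01 : 0 <= t <= 1 by rewrite t1 ltW.
have := fc y x t Uy Ux t01.
have -> : t *: y + (1 - t) *: x = x + t *: w.
  by rewrite /w scalerBr scalerBl scale1r addrCA.
move: h; move: ('d f x w) (f (x + t *: w)) (f x) (f y) => l a b c h1 h2.
have h3 : e / (`|w| + 1) * (t * `|w|) <= t * e.
  rewrite mulrCA ler_pM2l // mulrAC ler_pdivrMr // ler_pM2l //; lra.
rewrite -(ler_pM2l t0); lra.
Qed.

(** The form [l] is the Taylor error of the gradient at [y], represented by [eps], and
    [a *: (y - x)] represents the gradient of the regularizer. Minimality along segments makes minus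
    the model gradient a subgradient of [g]; adding the gradient of [f] leaves
    [eps - a *: (y - x)]. *)
Lemma step_subgradient (R : realType) (n k : nat) (B : 'M[R]_n) (U D : set 'rV[R]_n)
    (f g : 'rV[R]_n -> R) (L : R) (x y : 'rV[R]_n) :
  spd B -> open U -> diffn k.+2 U f -> D `<=` U -> convex_set_on D -> 0 <= L ->
  convex_on U f -> convex_on D g ->
  (forall y z u, D y -> D z -> Bnorm B u <= 1 ->
     `|Dd k.+2 u f y - Dd k.+2 u f z| <= L * Bnorm B (y - z)) ->
  D x -> D y ->
  (forall z, D z ->
     taylor k.+2 f x y + k.+2%:R * L / k.+3`!%:R * Bnorm B (y - x) ^+ k.+3 + g y
     <= taylor k.+2 f x z + k.+2%:R * L / k.+3`!%:R * Bnorm B (z - x) ^+ k.+3 + g z) ->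
  exists2 G : 'rV[R]_n,
    Bnorm B (G + (k.+2%:R * (L / k.+2`!%:R) * Bnorm B (y - x) ^+ k.+1) *: (y - x))
      <= L / k.+2`!%:R * Bnorm B (y - x) ^+ k.+2 &
    forall z, D z -> f y + g y + bform B G (z - y) <= f z + g z.
Proof.
move=> B_spd Uo df DU Dc L0 fc gc fL Dx Dy ymin.
pose l w := 'd f y w - \sum_(j < k.+2) (j`!%:R)^-1 * Dd j (y - x) (fun z => 'd f z w) x.
have l_lin : scalar l.
  move=> a v w.
  have comb (A A1 A2 S S1 S2 : R) : A = a * A1 + A2 -> S = a * S1 + S2 ->
    A - S = a * (A1 - S1) + (A2 - S2) by move=> -> ->; ring.
  apply: comb; first exact: (linearP ('d f y) a v w).
  rewrite mulr_sumr -big_split /=; apply: eq_bigr => j _.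
  have dj : diffn j.+1 U f := diffn_leq (ltn_ord j) df.
  have := Dd_diff_lin a 1 (y - x) v w Uo dj (DU _ Dx); rewrite scale1r => ->.
  by rewrite mul1r mulrDr mulrCA.
have [eps epsE] := bform_riesz B_spd l_lin.
have eps_le : Bnorm B eps <= L / k.+2`!%:R * Bnorm B (y - x) ^+ k.+2.
  (* Testing the error on its own representative gives the norm. *)
  have := gradient_taylor_bound eps B_spd Uo df DU Dc fL Dx Dy.
  rewrite -/(l eps) epsE -sqr_Bnorm // ger0_norm ?sqr_ge0 // expr2.
  have [->|e0] := eqVneq (Bnorm B eps) 0.
    by move=> _; rewrite mulr_ge0 ?exprn_ge0 ?Bnorm_ge0 // divr_ge0.
  by rewrite ler_pM2r // lt0r e0 Bnorm_ge0.
pose a := k.+2%:R * (L / k.+2`!%:R) * Bnorm B (y - x) ^+ k.+1.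
exists (eps - a *: (y - x)); first by rewrite subrK.
move=> z Dz; set w := z - y.
(* The right slope at [y] towards [z] of the smooth part of the model is that of the Taylor
   polynomial plus that of the regularizer. *)
have /poly_majorant_slope slope :
    poly_majorant (fun t => taylor k.+2 f x (y + t *: w) +
      k.+2%:R * L / k.+3`!%:R * Bnorm B ((y - x) + t *: w) ^+ k.+3)
    ('d f y w - l w + a * bform B (y - x) w).
  have -> : 'd f y w - l w + a * bform B (y - x) w =
     \sum_(1 <= j < k.+3) (j.-1`!%:R)^-1 * Dd j.-1 (y - x) (fun z => 'd f z w) x
     + k.+2%:R * L / k.+3`!%:R * (k.+3%:R * Bnorm B (y - x) ^+ k.+1 * bform B (y - x) w).
    rewrite /l subKr big_add1 big_mkord; congr (_ + _).
    have f0 : (k.+2`!%:R : R) != 0 by rewrite pnatr_eq0 -lt0n fact_gt0.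
    have s0 : (k.+3%:R : R) != 0 by rewrite pnatr_eq0.
    rewrite /a (factS k.+2) natrM.
    move: (k.+3%:R : R) s0 (k.+2`!%:R : R) f0 (k.+2%:R : R) => s s0 F f0 q.
    by field; rewrite f0 s0.
  apply: poly_majorantD; first exact: (poly_majorant_taylor _ _ Uo df (DU _ Dx)).
  apply: poly_majorantZ; last exact: poly_majorant_Bnorm.
  by rewrite divr_ge0 ?mulr_ge0.
have gle : g y - g z <= 'd f y w - l w + a * bform B (y - x) w.
  apply: slope => t /andP[t0 t1]; have t01 : 0 <= t <= 1 by rewrite t1 ltW.
  have tE : t *: z + (1 - t) *: y = y + t *: w.
    by rewrite /w scalerBr scalerBl scale1r addrCA.
  have := ymin _ (Dc _ _ _ Dz Dy t01); have := gc _ _ _ Dz Dy t01.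
  rewrite tE scale0r !addr0.
  have -> : y + t *: w - x = y - x + t *: w by rewrite addrAC.
  lra.
have fle : 'd f y w <= f z - f y.
  by apply: (convex_diff_le fc (DU _ Dy) (DU _ Dz)); exact: df.1 _ (DU _ Dy).
rewrite bformDl bformNl bformZl -epsE.
move: fle gle; move: ('d f y w) (l w) => d1 d2; lra.
Qed.
(** * Uniform convexity through proximal points *)

Lemma continuous_bform (R : realType) (n : nat) (B : 'M[R]_n) (z : 'rV[R]_n) :
  continuous (fun y : 'rV[R]_n => bform B (y - z) (y - z)).
Proof.
move=> y; rewrite /bform.
have coord i : {for y, continuous (fun y' : 'rV[R]_n => (y' - z) 0 i)}.
  have d : differentiable (fun y' : 'rV[R]_n => y' 0 i - z 0 i) y.
    by apply: differentiableB; [exact: differentiable_coord|exact: differentiable_cst].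
  have -> : (fun y' : 'rV[R]_n => (y' - z) 0 i) = (fun y' => y' 0 i - z 0 i).
    by apply/funext => y'; rewrite !mxE.
  exact: differentiable_continuous d.
have FF : Filter (nbhs y) := nbhs_filter y.
apply: (@cvg_big _ _ _ _ _ add_continuous _ (nbhs y)) => i _.
apply: (@cvg_big _ _ _ _ _ add_continuous _ (nbhs y)) => j _.
by apply: cvgM; [apply: cvgM; [exact: coord|exact: cvg_cst]|exact: coord].
Qed.

Lemma compact_closed_ball_rV (R : realType) (n : nat) (z : 'rV[R]_n) (r : R) :
  0 < r -> compact [set y | `|z - y| <= r].
Proof.
move=> r0; have <- : closed_ball z r = [set y | `|z - y| <= r] by rewrite closed_ballE.
apply: bounded_closed_compact; last exact: closed_ball_closed.
exists (r + `|z|); split; first exact: num_real.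
move=> M ltM y; rewrite closed_ballE //= => yr; apply: le_trans (ltW ltM).
by rewrite -[y](subKr z) (le_trans (ler_normB _ _)) // addrC lerD2r.
Qed.

Section ProximalPoint.
Variables (R : realType) (n : nat) (B : 'M[R]_n) (D : set 'rV[R]_n) (Phi : 'rV[R]_n -> R).
Variable m : R.
Hypotheses (B_spd : spd B) (D_convex : convex_set_on D) (Phi_convex : convex_on D Phi).
Hypothesis Phi_closed : closed [set z : 'rV[R]_n * R | D z.1 /\ Phi z.1 <= z.2].
Hypothesis Phi_ge : forall y, D y -> m <= Phi y.
Implicit Types (x y z G : 'rV[R]_n) (lam e : R).

Definition subgrad y G := forall z, D z -> Phi y + bform B G (z - y) <= Phi z.

(** As [Phi] is only lower semicontinuous, the minimum is taken over a compact piece of its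
    epigraph, where the objective [F] is continuous in both variables. *)
Lemma prox_exists lam z : 0 < lam -> D z ->
  exists2 y, D y & forall y', D y' ->
    Phi y + lam * Bnorm B (y - z) ^+ 2 <= Phi y' + lam * Bnorm B (y' - z) ^+ 2.
Proof.
move=> lam0 Dz.
have [M M0 normM] := mx_norm_le_Bnorm B_spd.
(* A competitor no worse than [z] has squared distance to [z] at most [A], hence distance at most
   [A + 1]. *)
pose A := (Phi z - m) / lam.
have A0 : 0 <= A by rewrite divr_ge0 ?subr_ge0 ?Phi_ge // ltW.
pose epi := [set w : 'rV[R]_n * R | D w.1 /\ Phi w.1 <= w.2].
pose K := ([set y | `|z - y| <= M * (A + 1)] `*` [set` `[m, Phi z]%R]) `&` epi.
have Kc : compact K.
  apply: compact_closedI => //; apply: compact_setX; last exact: segment_compact.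
  by apply: compact_closed_ball_rV; rewrite mulr_gt0 // ltr_wpDl.
have B0 : Bnorm B (z - z) = 0 by apply/eqP; rewrite Bnorm_eq0 // subrr.
have Kz : K (z, Phi z).
  split=> //; split=> /=; last by rewrite in_itv /= lexx Phi_ge.
  by rewrite subrr normr0 mulr_ge0 ?addr_ge0 // ltW.
pose F (w : 'rV[R]_n * R) := w.2 + lam * bform B (w.1 - z) (w.1 - z).
have Fc : continuous F.
  move=> w; apply: cvgD; first exact: cvg_snd.
  apply: cvgM; first exact: cvg_cst.
  apply: (@continuous_comp _ _ _ fst (fun y => bform B (y - z) (y - z)) w); [exact: cvg_fst|exact: continuous_bform].
have [|[y c] /set_mem[_ [/= Dy yc]] Fmin] := compact_EVT_min _ Kc (continuous_subspaceT Fc).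
  by exists (z, Phi z).
have FE y' : F (y', Phi y') = Phi y' + lam * Bnorm B (y' - z) ^+ 2 by rewrite sqr_Bnorm.
have Fy : F (y, Phi y) <= F (y, c) by rewrite /F /= lerD2r.
exists y => // y' Dy'; rewrite -!FE.
have Fz : F (y, Phi y) <= Phi z.
  apply: le_trans Fy (le_trans (Fmin _ (mem_set Kz)) _).
  by rewrite FE B0 expr0n mulr0 addr0.
have [far|near] := ltP (Phi z) (F (y', Phi y')); first exact: le_trans Fz (ltW far).
apply: le_trans Fy (Fmin _ (mem_set _)).
have sq0 : 0 <= lam * Bnorm B (y' - z) ^+ 2 by rewrite mulr_ge0 ?sqr_ge0 // ltW.
rewrite FE in near; split=> //; split=> /=; last first.
  by rewrite in_itv /= Phi_ge //=; lra.
rewrite distrC (le_trans (normM _)) // ler_pM2l //.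
have : Bnorm B (y' - z) ^+ 2 <= A.
  rewrite ler_pdivlMr // mulrC; have := Phi_ge Dy'; lra.
have := Bnorm_ge0 B (y' - z); move: (Bnorm B (y' - z)) => t t0 tA.
have := sqr_ge0 (t - 1); nra.
Qed.

Lemma prox_subgrad lam y z : 0 < lam -> D y ->
  (forall y', D y' -> Phi y + lam * Bnorm B (y - z) ^+ 2 <= Phi y' + lam * Bnorm B (y' - z) ^+ 2) ->
  subgrad y ((2 * lam) *: (z - y)).
Proof.
move=> lam0 Dy ymin w Dw.
have maj := poly_majorantZ (ltW lam0) (poly_majorant_Bnorm 0 (y - z) (w - y) B_spd).
have : Phi y - Phi w <= lam * (2%:R * Bnorm B (y - z) ^+ 0 * bform B (y - z) (w - y)).
  apply: (poly_majorant_slope maj) => t /andP[t0 t1].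
  have t01 : 0 <= t <= 1 by rewrite t1 ltW.
  have := ymin _ (D_convex Dw Dy t01); have := Phi_convex Dw Dy t01.
  have -> : t *: w + (1 - t) *: y = y + t *: (w - y).
    by rewrite scalerBr scalerBl scale1r addrCA.
  have -> : y + t *: (w - y) - z = y - z + t *: (w - y) by rewrite addrAC.
  rewrite scale0r addr0; lra.
by rewrite -(opprB y z) scalerN bformNl bformZl expr0; lra.
Qed.

Lemma Phi_lsc z e : D z -> 0 < e ->
  exists2 d : R, 0 < d & forall y, D y -> Bnorm B (y - z) < d -> Phi z - e <= Phi y.
Proof.
move=> Dz e0; have [M M0 normM] := mx_norm_le_Bnorm B_spd.
pose epi := [set w : 'rV[R]_n * R | D w.1 /\ Phi w.1 <= w.2].
have nepi : (~` epi) (z, Phi z - e) by move=> [_] /=; lra.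
have /nbhs_ballP[d /= d0 dE] :=
  open_nbhs_nbhs (conj (closed_openC Phi_closed) nepi).
exists (d / M); first exact: divr_gt0.
move=> y Dy yd; rewrite leNgt; apply/negP => lt.
have [] : ~ epi (y, Phi z - e); last by split=> //=; exact: ltW.
apply: dE; split=> /=; last exact: ballxx.
rewrite -ball_normE /= distrC (le_lt_trans (normM _)) // mulrC -ltr_pdivlMr //.
Qed.

(** A proximal point with large [lam] is close to [z], and its subgradient is a positive multiple of
    [z - y], whence the sign in the last clause. *)
Lemma near_subgrad z e : D z -> 0 < e ->
  exists y G, [/\ D y, subgrad y G, Bnorm B (y - z) < e, Phi z - e <= Phi y &
    0 <= bform B G (z - y)].
Proof.
move=> Dz e0; have [d d0 dE] := Phi_lsc Dz e0.
pose r := Num.min d e.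
have r0 : 0 < r by rewrite lt_min d0.
have Pm : 0 < Phi z - m + 1 by rewrite ltr_wpDl // subr_ge0 Phi_ge.
(* Chosen so that [lam * |y - z| ^+ 2 <= Phi z - m < lam * r ^+ 2]. *)
pose lam := (Phi z - m + 1) / r ^+ 2.
have lam0 : 0 < lam by rewrite divr_gt0 ?exprn_gt0.
have [y Dy ymin] := prox_exists lam0 Dz.
have yr : Bnorm B (y - z) < r.
  rewrite -(ltr_pXn2r (ltn0Sn 1)) ?nnegrE ?Bnorm_ge0 ?(ltW r0) //.
  rewrite -(ltr_pM2l lam0) [ltRHS]divfK ?gt_eqF ?exprn_gt0 //.
  have B0 : Bnorm B (z - z) = 0 by apply/eqP; rewrite Bnorm_eq0 // subrr.
  have := ymin _ Dz; rewrite B0 expr0n mulr0 addr0; have := Phi_ge Dy; lra.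
move: yr; rewrite lt_min => /andP[yd ye].
exists y, ((2 * lam) *: (z - y)); split=> //; first exact: prox_subgrad ymin.
  exact: dE.
by rewrite bformZl mulr_ge0 ?bform_ge0 // mulr_ge0 // ltW.
Qed.
End ProximalPoint.

(** * Integrating strong monotonicity along a segment *)

(** Young's inequality for [a] and [c ^ (q - 1)] with exponents [q] and [q / (q - 1)]. *)
Lemma powR_tangent_le (R : realType) (q a c : R) : 1 < q -> 0 <= a -> 0 <= c ->
  c `^ q + q * c `^ (q - 1) * (a - c) <= a `^ q.
Proof.
move=> q1 a0 c0; have q0 : 0 < q by lra.
have q10 : 0 < q - 1 by lra.
have [->|cn0] := eqVneq c 0.
  rewrite !powR0 ?gt_eqF // mulr0 mul0r addr0; exact: powR_ge0.
have conj : q^-1 + (q / (q - 1))^-1 = 1 by field; rewrite !gt_eqF.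
have := conjugate_powR a0 (powR_ge0 c (q - 1)) q0 (divr_gt0 q0 q10) conj.
rewrite -powRrM [(q - 1) * _]mulrC divfK ?gt_eqF // => h.
have cq : c `^ q = c * c `^ (q - 1) by rewrite mulr_powRB1.
move: h; rewrite -(ler_pM2l q0) mulrDr [q * (a `^ q / q)]mulrC divfK ?gt_eqF //.
have -> : q * (c `^ q / (q / (q - 1))) = (q - 1) * c `^ q by field; rewrite !gt_eqF.
rewrite cq; move: (c `^ (q - 1)) (a `^ q) => X Y; lra.
Qed.

Section UniformConvexity.
Variables (R : realType) (n : nat) (B : 'M[R]_n) (D : set 'rV[R]_n) (Phi : 'rV[R]_n -> R).
Variables (m sigma q : R).
Hypotheses (B_spd : spd B) (D_convex : convex_set_on D) (Phi_convex : convex_on D Phi).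
Hypothesis Phi_closed : closed [set z : 'rV[R]_n * R | D z.1 /\ Phi z.1 <= z.2].
Hypothesis Phi_ge : forall y, D y -> m <= Phi y.
Hypotheses (sigma_gt0 : 0 < sigma) (q_gt1 : 1 < q).
Notation sub := (subgrad B D Phi).
Hypothesis sub_mono : forall y z Gy Gz, D y -> D z -> sub y Gy -> sub z Gz ->
  sigma * Bnorm B (y - z) `^ q <= bform B (Gy - Gz) (y - z).
Variables (y0 y1 G : 'rV[R]_n).
Hypotheses (Dy0 : D y0) (Dy1 : D y1) (sG : sub y1 G).

Let d := y1 - y0.
Let pt t := y0 + t *: d.

Let Dpt t : 0 <= t <= 1 -> D (pt t).
Proof.
move=> t01; have := D_convex Dy1 Dy0 t01.
by congr D; rewrite /pt /d scalerBr scalerBl scale1r addrCA.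
Qed.

(* [pt t] itself may have no subgradient, so nearby points are used. *)
Let secant_le s t : 0 <= s -> s < t -> t < 1 ->
  Phi (pt t) - Phi (pt s) <=
    (t - s) * (bform B G d - sigma * Bnorm B d `^ q * (1 - t) `^ (q - 1)).
Proof.
move=> s0 st t1.
have t01 : 0 <= t <= 1 by apply/andP; split; lra.
have s01 : 0 <= s <= 1 by apply/andP; split; lra.
have [c cE] : exists c, c = (1 - t) * Bnorm B d by exists ((1 - t) * Bnorm B d).
have t10 : 0 < 1 - t by lra.
have c0 : 0 <= c by rewrite cE mulr_ge0 ?Bnorm_ge0 // ltW.
have cq : c `^ q = (1 - t) * (Bnorm B d `^ q * (1 - t) `^ (q - 1)).
  rewrite cE powRM ?Bnorm_ge0 ?(ltW t10) // mulrC mulrCA; congr (_ * _).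
  by rewrite mulr_powRB1 ?(ltW t10) // (lt_trans _ q_gt1).
(* Monotonicity between [y1] and [pt t] involves the displacement [(1 - t) *: d], so everything is
   scaled by [1 - t]. *)
rewrite -(ler_pM2l t10); apply/ler_addgt0Pr => e e0.
(* [K] collects the coefficients of every error caused by moving from [pt t] to [y]; with distance
   below [e / K] they total at most [e]. *)
have [K KE] : exists K, K = 1 + (t - s) * (sigma * (q * c `^ (q - 1)) + Bnorm B G) by eexists.
have K0 : 0 < K.
  rewrite KE ltr_wpDr // mulr_ge0 ?subr_ge0 ?(ltW st) // addr_ge0 ?Bnorm_ge0 //.
  by rewrite !mulr_ge0 ?powR_ge0 ?ltW // (lt_trans _ q_gt1).
have [y [g [Dy sg ylt Phiy gzy]]] :=
  near_subgrad B_spd D_convex Phi_convex Phi_closed Phi_ge (Dpt t01) (divr_gt0 e0 K0).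
have eK : K * (e / K) = e by rewrite mulrC divfK ?gt_eqF.
have eta0 : 0 < e / K by rewrite divr_gt0.
move: (e / K) eK eta0 ylt Phiy => eta eK eta0 ylt Phiy.
set z := pt t in ylt Phiy gzy *; set v := z - y in gzy.
have vE : Bnorm B v = Bnorm B (y - z) by rewrite -BnormN opprB.
have zsE : pt s - y = v - (t - s) *: d.
  by rewrite /v /z /pt; apply/rowP => i; rewrite !mxE; ring.
have yE : y1 - y = (1 - t) *: d + v.
  by rewrite /v /z /pt /d; apply/rowP => i; rewrite !mxE; ring.
(* The term [bform B g v] is dropped thanks to its sign; the norm of [g] is not controlled. *)
have h1 : Phi y - Phi (pt s) <= (t - s) * bform B g d.
  have := sg _ (Dpt s01); rewrite zsE (bformDr B v (- ((t - s) *: d))) bformNr bformZr.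
  move: (bform B g v) gzy (bform B g d) (Phi y) (Phi (pt s)) => a1 a10 a2 a3 a4.
  lra.
have h2 : (1 - t) * bform B g d <= (1 - t) * bform B G d - sigma * Bnorm B (y1 - y) `^ q
    + bform B G v.
  have := sub_mono Dy1 Dy sG sg.
  rewrite [X in bform B _ X]yE (bformDl B G (- g)) bformNl.
  rewrite !(bformDr B ((1 - t) *: d) v) !bformZr.
  move: (bform B G v) (bform B g v) gzy (bform B G d) (bform B g d) => a1 a2 a20 a3 a4.
  move: (sigma * _) => a5; lra.
have h3 : bform B G v <= Bnorm B G * eta.
  by rewrite (le_trans (bform_le B_spd _ _)) // ler_wpM2l ?Bnorm_ge0 // vE ltW.
have h4 : c `^ q - q * c `^ (q - 1) * eta <= Bnorm B (y1 - y) `^ q.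
  apply: le_trans (powR_tangent_le q_gt1 (Bnorm_ge0 B (y1 - y)) c0).
  have q_ge0 : 0 <= q by rewrite ltW // (lt_trans _ q_gt1).
  rewrite -mulrN lerD2l ler_wpM2l ?mulr_ge0 ?powR_ge0 //.
  have := BnormD B_spd (y1 - y) (- v); rewrite yE addrK BnormN vE BnormZ gtr0_norm //.
  rewrite -cE; lra.
have h5 : sigma * (c `^ q - q * c `^ (q - 1) * eta) <= sigma * Bnorm B (y1 - y) `^ q.
  by rewrite ler_pM2l.
have h6 : (1 - t) * bform B g d <= (1 - t) * bform B G d - sigma * c `^ q
    + (sigma * (q * c `^ (q - 1)) + Bnorm B G) * eta by lra.
have ts0 : 0 <= t - s by rewrite subr_ge0 ltW.
have h7 := ler_wpM2l ts0 h6.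
have h8 := ler_wpM2l (ltW t10) h1.
have h9 : (1 - t) * eta <= eta by rewrite ler_piMl ?(ltW eta0) // gerBl; case/andP: t01.
have h10 : (1 - t) * (Phi z - eta) <= (1 - t) * Phi y by rewrite ler_pM2l.
move: h7 h8 h9 h10 eK; rewrite KE cq.
move: (bform B g d) (bform B G d) (Bnorm B d `^ q) ((1 - t) `^ (q - 1)) (c `^ (q - 1)) (Bnorm B G).
move: (Phi y) (Phi z) (Phi (pt s)) => a1 a2 a3 a4 a5 a6 a7 a8 a9.
lra.
Qed.

(** Secants over a uniform grid are bounded by right Riemann sums of [b], whose primitive is [beta].
    As [b] is nondecreasing, these exceed the integral by at most [(b 1 - b 0) / N], which tends to
    [0]. *)
Lemma uniform_convex_lower :
  Phi y1 - Phi y0 <= bform B G d - sigma / q * Bnorm B d `^ q.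
Proof.
pose b t := bform B G d - sigma * Bnorm B d `^ q * (1 - t) `^ (q - 1).
pose beta t := bform B G d * t + sigma * Bnorm B d `^ q / q * (1 - t) `^ q.
have q0 : 0 < q by rewrite (lt_trans _ q_gt1).
have sd0 : 0 <= sigma * Bnorm B d `^ q by rewrite mulr_ge0 ?powR_ge0 // ltW.
have secant s t : 0 <= s -> s < t -> t <= 1 -> Phi (pt t) - Phi (pt s) <= (t - s) * b t.
  (* At [t = 1] the point is [y1] itself, so its subgradient [G] serves directly. *)
  move=> s0 st; rewrite le_eqVlt => /orP[/eqP t1|t1]; last exact: secant_le.
  have s01 : 0 <= s <= 1 by rewrite s0 ltW // -t1.
  have := sG (Dpt s01); rewrite /b t1 subrr powR0 ?gt_eqF ?subr_gt0 // mulr0 subr0.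
  have -> : pt 1 = y1 by rewrite /pt scale1r addrC subrK.
  have -> : pt s - y1 = - ((1 - s) *: d).
    by rewrite /pt /d; apply/rowP => i; rewrite !mxE; ring.
  rewrite bformNr bformZr; lra.
have tangent s t : s <= t -> t <= 1 -> (t - s) * b s <= beta t - beta s.
  move=> st t1.
  have s10 : 0 <= 1 - s by lra. have t10 : 0 <= 1 - t by lra.
  have := powR_tangent_le q_gt1 t10 s10.
  rewrite /b /beta; move: sd0; set A := sigma * _.
  move: (bform B G d) ((1 - s) `^ q) ((1 - t) `^ q) ((1 - s) `^ (q - 1)) => g S T U A0 h.
  have h' : A / q * (S + q * U * (1 - t - (1 - s))) <= A / q * T.
    by rewrite ler_wpM2l // divr_ge0 // ltW.
  have e : A / q * (S + q * U * (1 - t - (1 - s))) = A / q * S + A * U * (s - t).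
    by field; rewrite gt_eqF.
  lra.
have step (N : nat) : (0 < N)%N ->
    Phi y1 - Phi y0 <= bform B G d - sigma / q * Bnorm B d `^ q + sigma * Bnorm B d `^ q / N%:R.
  move=> N0; have NR : 0 < N%:R :> R by rewrite ltr0n.
  pose t i : R := i%:R / N%:R.
  have tS i : t i.+1 - t i = N%:R^-1 by rewrite /t -mulrBl -natrB // subSnn mul1r.
  have tle i : (i <= N)%N -> 0 <= t i <= 1.
    by move=> iN; rewrite divr_ge0 //= ler_pdivrMr // mul1r ler_nat.
  have tel i : (i <= N)%N -> Phi (pt (t i)) - Phi (pt (t 0%N)) <=
      beta (t i) - beta (t 0%N) + (b (t i) - b (t 0%N)) / N%:R.
    elim: i => [_|i IH iN]; first by rewrite !subrr mul0r addr0.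
    have /andP[ti0 _] := tle _ (ltnW iN); have /andP[_ tS1] := tle _ iN.
    have tlt : t i < t i.+1 by rewrite -subr_gt0 tS invr_gt0.
    have := secant _ _ ti0 tlt tS1; have := tangent _ _ (ltW tlt) tS1.
    have := IH (ltnW iN); rewrite tS; move: (N%:R^-1) => r; lra.
  have := tel N (leqnn N).
  have -> : t N = 1 by rewrite /t divff ?gt_eqF.
  have -> : t 0%N = 0 by rewrite /t mul0r.
  have -> : pt 1 = y1 by rewrite /pt scale1r addrC subrK.
  have -> : pt 0 = y0 by rewrite /pt scale0r addr0.
  rewrite /b /beta subrr subr0 !powR1 !powR0 ?gt_eqF ?subr_gt0 //.
  move: (Phi y1) (Phi y0) (bform B G d) (Bnorm B d `^ q) => a c g e h.
  by apply: le_trans h _; rewrite le_eqVlt; apply/orP; left; apply/eqP; field; rewrite !gt_eqF.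
apply/ler_addgt0Pr => e e0.
set A := sigma * Bnorm B d `^ q in sd0 step.
have Ae0 : 0 <= A / e by rewrite divr_ge0 // ltW.
have := archi_boundP Ae0; set N := Num.Def.archi_bound _ => AN.
have N0 : (0 < N)%N by rewrite -(ltr0n R) (le_lt_trans Ae0).
apply: le_trans (step _ N0) _; rewrite lerD2l ler_pdivrMr ?ltr0n // mulrC -ler_pdivrMr //.
exact: ltW.
Qed.
End UniformConvexity.
(** A limit point must first be shown to lie in [domh h], since [f] is controlled only on [U]. An
    affine minorant of [f] is continuous everywhere and does this; then continuity of [f] at the
    limit concludes. *)
Lemma closed_epi_add (R : realType) (n : nat) (U : set 'rV[R]_n) (f : 'rV[R]_n -> R)
    (h : 'rV[R]_n -> \bar R) (x0 : 'rV[R]_n) :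
  (forall x, h x != -oo%E) -> closed_fun h -> domh h `<=` U -> domh h x0 ->
  convex_on U f -> (forall x, U x -> differentiable f x) ->
  closed [set z : 'rV[R]_n * R | domh h z.1 /\ f z.1 + fine (h z.1) <= z.2].
Proof.
move=> hN hc DU Dx0 fc df.
set epi := [set z | _]; rewrite closure_id; apply/seteqP; split; first exact: subset_closure.
move=> [y c]; rewrite closureEcvg => -[G Gp [Gyc epiG]].
have hfin z : domh h z -> h z = (fine (h z))%:E.
  by move=> Dz; rewrite fineK // fin_numE hN /= lt_eqF.
have key (phi : 'rV[R]_n -> R) : {for y, continuous phi} ->
    (forall z, domh h z -> phi z <= f z) -> (h y <= (c - phi y)%:E)%E.
  move=> phic phile.
  have [G1 G2] : (fst @ G --> y) /\ (snd @ G --> c).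
    split; first exact: cvg_trans (cvg_app fst Gyc) cvg_fst.
    exact: cvg_trans (cvg_app snd Gyc) cvg_snd.
  have G3 : (fun w : 'rV[R]_n * R => w.2 - phi w.1) w @[w --> G] --> c - phi y.
    by apply: cvgB; [exact: G2|exact: cvg_comp G1 phic].
  have cv : (fun w : 'rV[R]_n * R => (w.1, w.2 - phi w.1)) w @[w --> G] --> (y, c - phi y).
    exact: (cvg_pair G1 G3).
  have near : \near G, [set z : 'rV[R]_n * R | (h z.1 <= z.2%:E)%E] (G.1, G.2 - phi G.1).
    apply: epiG => -[z e] /= [Dz ze]; rewrite /= hfin // lee_fin /= lerBrDl.
    by apply: le_trans ze; rewrite lerD2r phile.
  exact: (@closed_cvg _ _ G Gp (fun w : 'rV[R]_n * R => (w.1, w.2 - phi w.1)) _ hc near _ cv).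
have Dy : domh h y.
  have affc : {for y, continuous (fun z : 'rV[R]_n => f x0 + 'd f x0 (z - x0))}.
    have dc := diff_continuous (df _ (DU _ Dx0)).
    apply: continuousD; first exact: cst_continuous.
    apply: (@continuous_comp _ _ _ (fun z : 'rV[R]_n => z - x0) ('d f x0)); last exact: dc.
    by apply: continuousB; [exact: cvg_id|exact: cst_continuous].
  have affle z : domh h z -> f x0 + 'd f x0 (z - x0) <= f z.
    by move=> Dz; have := convex_diff_le fc (DU _ Dx0) (DU _ Dz) (df _ (DU _ Dx0)); lra.
  exact: le_lt_trans (key _ affc affle) (ltry _).
split=> //=.
have := key f (differentiable_continuous (df _ (DU _ Dy))) (fun z _ => lexx _).
by rewrite hfin // lee_fin; lra.
Qed.

(** * Rate of decrease *)

(** With [p = k.+2], Young's inequality for the exponents [2p / (p + 1)] and [2p / (p - 1)]. *)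
Lemma young_natexp (R : realType) (k : nat) (a b : R) : 0 <= a -> 0 <= b ->
  2 * k.+2%:R * (a ^+ k.+3 * b ^+ k.+1) <=
    k.+3%:R * a ^+ (2 * k.+2) + k.+1%:R * b ^+ (2 * k.+2).
Proof.
move=> a0 b0.
have p0 : 0 < k.+2%:R :> R by rewrite ltr0n.
have pE : k.+3%:R = k.+2%:R + 1 :> R by rewrite -natr1.
have mE : k.+1%:R = k.+2%:R - 1 :> R by rewrite -[k.+2%:R]natr1 addrK.
have s0 : 0 < k.+3%:R :> R by rewrite ltr0n.
have m0 : 0 < k.+1%:R :> R by rewrite ltr0n.
have conj : (2 * k.+2%:R / k.+3%:R)^-1 + (2 * k.+2%:R / k.+1%:R)^-1 = 1 :> R.
  move: (k.+2%:R : R) (k.+3%:R : R) (k.+1%:R : R) pE mE p0 s0 m0 => P S M -> -> P0 S0 M0.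
  by field; rewrite !gt_eqF.
have al0 : 0 < 2 * k.+2%:R / k.+3%:R :> R by rewrite divr_gt0 ?mulr_gt0.
have be0 : 0 < 2 * k.+2%:R / k.+1%:R :> R by rewrite divr_gt0 ?mulr_gt0.
have := conjugate_powR (exprn_ge0 k.+3 a0) (exprn_ge0 k.+1 b0) al0 be0 conj.
have powE (x : R) i : 0 <= x -> (x ^+ i.+1) `^ (2 * k.+2%:R / i.+1%:R) = x ^+ (2 * k.+2).
  move=> x0; have -> : x ^+ (2 * k.+2) = x `^ (2 * k.+2%:R) by rewrite -powR_mulrn // natrM.
  by rewrite -powR_mulrn // -powRrM [_ * (_ / _)]mulrC divfK ?pnatr_eq0.
rewrite !powE //; move: (a ^+ (2 * k.+2)) (b ^+ (2 * k.+2)) (_ * _) => X Y Z.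
move: (k.+2%:R : R) (k.+3%:R : R) (k.+1%:R : R) p0 s0 m0 => P S M P0 S0 M0 h.
rewrite -(ler_pM2l (mulr_gt0 (ltr0n R 2) P0)) in h.
apply: le_trans h _; rewrite le_eqVlt; apply/orP; left; apply/eqP.
by field; rewrite !gt_eqF.
Qed.

(** With [p = k.+2], squaring the hypothesis gives [main], a lower bound for [Y] depending on [r].
    It is minimized over [r], and the minimum is expressed through [N] alone. *)
Lemma step_inner_ge (R : realType) (n k : nat) (B : 'M[R]_n) (G u : 'rV[R]_n) (c : R) :
  spd B -> 0 < c ->
  Bnorm B (G + (k.+2%:R * c * Bnorm B u ^+ k.+1) *: u) <= c * Bnorm B u ^+ k.+2 ->
  bform B G u <= 0 /\
  Bnorm B G ^+ k.+3 <= k.+3%:R * c * (- bform B G u) ^+ k.+2.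
Proof.
move=> B_spd c0 h.
set r := Bnorm B u in h; set N := Bnorm B G; set Y := - bform B G u.
have N0 : 0 <= N := Bnorm_ge0 _ _.
have r0 : 0 <= r := Bnorm_ge0 _ _.
have main : N ^+ 2 + (k.+2%:R ^+ 2 - 1) * c ^+ 2 * r ^+ (2 * k.+2)
    <= 2 * k.+2%:R * c * r ^+ k.+1 * Y.
  have h2 : Bnorm B (G + (k.+2%:R * c * r ^+ k.+1) *: u) ^+ 2 <= (c * r ^+ k.+2) ^+ 2.
    by rewrite lerXn2r // nnegrE ?Bnorm_ge0 // mulr_ge0 ?exprn_ge0 // ltW.
  move: h2; rewrite sqr_BnormD // bformZr BnormZ [X in _ + X <= _]exprMn real_normK ?num_real //.
  rewrite -/r -/N [bform B G u](_ : _ = - Y); last by rewrite opprK.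
  have -> : r ^+ (2 * k.+2) = (r ^+ k.+1 * r) ^+ 2 by rewrite -exprSr -exprM mulnC.
  rewrite [r ^+ k.+2]exprSr; move: (r ^+ k.+1) (k.+2%:R : R) => X P; clearbody r N Y; lra.
have [r00|rn0] := eqVneq r 0.
  move: main; rewrite r00 !exprS !mul0r !mulr0 mul0r addr0 expr0 mulr1 => N20.
  have N00 : N = 0.
    by apply/eqP; rewrite -sqrf_eq0 eq_le sqr_ge0 andbT expr2.
  have u0 : u = 0 by apply/eqP; rewrite -(Bnorm_eq0 B_spd) -/r r00.
  have bu : bform B G u = 0 by rewrite u0 bform0r.
  split; first by rewrite bu.
  by rewrite N00 /Y bu oppr0 !mul0r mulr0.
have rp : 0 < r by rewrite lt0r rn0.
have s0 : 0 < k.+3%:R * c by rewrite mulr_gt0.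
(* The minimizing value of [r]: it solves [N = (p + 1) c rho ^ p], and the minimum is [N * rho]. *)
pose rho := (N / (k.+3%:R * c)) `^ (k.+2%:R^-1).
have rho0 : 0 <= rho := powR_ge0 _ _.
have rhoE : N = k.+3%:R * c * rho ^+ k.+2.
  rewrite -powR_mulrn // -powRrM mulVf ?pnatr_eq0 // powRr1 ?divr_ge0 ?(ltW s0) //.
  by rewrite mulrC divfK // gt_eqF.
have Yge : N * rho <= Y.
  have K0 : 0 < 2 * k.+2%:R * c * r ^+ k.+1 by rewrite !mulr_gt0 ?exprn_gt0.
  rewrite -(ler_pM2l K0); apply: le_trans _ main.
  have yg := young_natexp k rho0 r0.
  have cc : 0 <= k.+3%:R * c ^+ 2 by rewrite mulr_ge0 ?sqr_ge0.
  have := ler_wpM2l cc yg.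
  have e1 : N * rho = k.+3%:R * c * rho ^+ k.+3 by rewrite {1}rhoE -mulrA -exprSr.
  have e2 : N ^+ 2 = (k.+3%:R * c) ^+ 2 * rho ^+ (2 * k.+2).
    by rewrite rhoE exprMn -exprM mulnC.
  rewrite e1 e2.
  have pE : k.+3%:R = k.+2%:R + 1 :> R by rewrite -natr1.
  have mE : k.+1%:R = k.+2%:R - 1 :> R by rewrite -[k.+2%:R]natr1 addrK.
  rewrite pE mE.
  move: (rho ^+ k.+3) (rho ^+ (2 * k.+2)) (r ^+ (2 * k.+2)) (r ^+ k.+1) (k.+2%:R : R) => a1 a2 a3 a4 P.
  clearbody r N Y rho; lra.
have Y0 : 0 <= Y by apply: le_trans Yge; rewrite mulr_ge0.
split; first by rewrite -oppr_ge0.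
have : (N * rho) ^+ k.+2 <= Y ^+ k.+2 by rewrite lerXn2r // nnegrE ?mulr_ge0.
rewrite -(ler_pM2l s0); apply: le_trans; rewrite exprMn mulrCA -rhoE.
by rewrite -exprSr.
Qed.

(** The right side of the last hypothesis is maximal at [s = kappa], where
    [sigma * kappa ^ (q - 1) = N], with value [(q - 1) / q * N * kappa]. *)
Lemma growth_to_gradient (R : realType) (q sigma N s de : R) :
  2 <= q -> 0 < sigma -> 0 <= N -> 0 <= s -> 0 <= de ->
  de <= N * s - sigma / q * s `^ q ->
  de `^ (q - 1) <= ((q - 1) / q) `^ (q - 1) * (N `^ q / sigma).
Proof.
move=> q2 sig0 N0 s0 de0 h.
have q0 : 0 < q by lra.
have q10 : 0 < q - 1 by lra.
have Ns0 : 0 <= N / sigma by rewrite divr_ge0 // ltW.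
pose kappa := (N / sigma) `^ ((q - 1)^-1).
have k0 : 0 <= kappa := powR_ge0 _ _.
have kq1 : kappa `^ (q - 1) = N / sigma.
  by rewrite -powRrM mulVf ?powRr1 // gt_eqF.
have kq : kappa `^ q = kappa * (N / sigma) by rewrite -kq1 mulr_powRB1.
have tg : kappa `^ q + q * kappa `^ (q - 1) * (s - kappa) <= s `^ q.
  by apply: powR_tangent_le => //; lra.
have : de <= (q - 1) / q * (N * kappa).
  have sq : 0 <= sigma / q by rewrite divr_ge0 // ltW.
  have := ler_wpM2l sq tg; rewrite kq kq1.
  have -> : sigma / q * (kappa * (N / sigma) + q * (N / sigma) * (s - kappa)) =
    kappa * N / q + N * (s - kappa) by field; rewrite !gt_eqF.
  have -> : (q - 1) / q * (N * kappa) = N * kappa - kappa * N / q by field; rewrite gt_eqF.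
  lra.
move=> hde.
have qq0 : 0 <= (q - 1) / q by rewrite divr_ge0 // ltW.
have := ge0_ler_powR (ltW q10) de0 (le_trans de0 hde) hde.
move=> /le_trans; apply.
rewrite (powRM _ qq0 (mulr_ge0 N0 k0)) (powRM _ N0 k0) kq1 -(mulr_powRB1 N0 q0).
by rewrite le_eqVlt; apply/orP; left; apply/eqP; ring.
Qed.

(** Split [p = (q - 1) + ga]: the power [q - 1] of [de] is bounded by [growth_to_gradient], the
    power [ga] by [de <= N * Dm]. The product contains [N ^ (p + 1)], exactly what the step
    inequality bounds. *)
Lemma gradient_to_decrease (R : realType) (k : nat) (q sigma L N Y Dm s de : R) :
  2 <= q -> q <= k.+3%:R -> 0 < sigma -> 0 < L -> 0 <= N -> 0 <= s -> s <= Dm -> 0 <= de ->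
  de <= N * s - sigma / q * s `^ q ->
  0 <= Y -> N ^+ k.+3 <= k.+3%:R * (L / k.+2`!%:R) * Y ^+ k.+2 ->
  de <= (k.+3%:R / k.+2`!%:R * ((q - 1) / q) `^ (q - 1)
          * (L * Dm `^ (k.+2%:R - q + 1) / sigma)) `^ (k.+2%:R^-1) * Y.
Proof.
move=> q2 qp sig0 L0 N0 s0 sD de0 h Y0 NY.
have q0 : 0 < q by lra.
have Dm0 : 0 <= Dm by lra.
have f0 : 0 < k.+2`!%:R :> R by rewrite ltr0n fact_gt0.
set al := ((q - 1) / q) `^ (q - 1).
set ga := k.+2%:R - q + 1.
have ga0 : 0 <= ga by rewrite /ga; move: qp; rewrite -[k.+3%:R]natr1; lra.
have al0 : 0 <= al := powR_ge0 _ _.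
set om := _ * (L * _ / sigma).
have om0 : 0 <= om by rewrite /om !mulr_ge0 ?invr_ge0 ?powR_ge0 ?ler0n // ltW.
have [->|den0] := eqVneq de 0; first by rewrite mulr_ge0 ?powR_ge0.
have dep : 0 < de by rewrite lt0r den0.
have deND : de <= N * Dm.
  have : 0 <= sigma / q * s `^ q by rewrite mulr_ge0 ?powR_ge0 // divr_ge0 // ltW.
  have := ler_wpM2l N0 sD; lra.
have Np : 0 < N.
  by rewrite lt0r N0 andbT; apply: contraTneq (lt_le_trans dep deND) => ->; rewrite mul0r ltxx.
have g1 := growth_to_gradient q2 sig0 N0 s0 de0 h.
have g2 : de `^ ga <= N `^ ga * Dm `^ ga.
  by rewrite -powRM //; apply: ge0_ler_powR => //; rewrite nnegrE ?mulr_ge0.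
have key : de ^+ k.+2 <= om * Y ^+ k.+2.
  have -> : de ^+ k.+2 = de `^ (q - 1) * de `^ ga.
    rewrite -powR_mulrn // -powRD ?den0 ?implybT //; congr (_ `^ _); rewrite /ga; lra.
  have := ler_pM (powR_ge0 _ _) (powR_ge0 _ _) g1 g2.
  move=> /le_trans; apply.
  have NE : N `^ q * N `^ ga = N ^+ k.+3.
    rewrite -powR_mulrn // -powRD ?(gt_eqF Np) ?implybT //; congr (_ `^ _).
    rewrite /ga -[k.+3%:R]natr1; lra.
  have -> : al * (N `^ q / sigma) * (N `^ ga * Dm `^ ga) = al * Dm `^ ga / sigma * N ^+ k.+3.
    by rewrite -NE; ring.
  have a0 : 0 <= al * Dm `^ ga / sigma by rewrite !mulr_ge0 ?powR_ge0 // invr_ge0 ltW.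
  apply: le_trans (ler_wpM2l a0 NY) _.
  by rewrite le_eqVlt; apply/orP; left; apply/eqP; rewrite /om; ring.
have p0 : k.+2%:R != 0 :> R by rewrite pnatr_eq0.
have p1 : 0 <= k.+2%:R^-1 :> R by rewrite invr_ge0.
have pw (x : R) : 0 <= x -> (x ^+ k.+2) `^ (k.+2%:R^-1) = x.
  by move=> x0; rewrite -powR_mulrn // -powRrM mulfV // powRr1.
have := ge0_ler_powR p1 (exprn_ge0 _ de0) (mulr_ge0 om0 (exprn_ge0 _ Y0)) key.
by rewrite (powRM _ om0 (exprn_ge0 _ Y0)) !pw.
Qed.

(** Each step contracts by [W / (1 + W) = 1 - 1 / (1 + W)], at most [exp (- 1 / (1 + W))]. *)
Lemma geometric_exp_rate (R : realType) (W : R) (de : nat -> R) : 0 <= W ->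
  (forall k, 0 <= de k) -> (forall k, de k.+1 <= W * (de k - de k.+1)) ->
  forall k, de k <= expR (- (k%:R / (1 + W))) * de 0%N.
Proof.
move=> W0 de0 step; have W1 : 0 < 1 + W by lra.
elim=> [|k IH]; first by rewrite mul0r oppr0 expR0 mul1r.
have -> : - (k.+1%:R / (1 + W)) = - (1 + W)^-1 + - (k%:R / (1 + W)).
  by rewrite -natr1; field; rewrite gt_eqF.
rewrite expRD -mulrA; apply: le_trans (ler_wpM2l (expR_ge0 _) IH).
apply: le_trans (ler_wpM2r (de0 k) (expR_ge1Dx _)).
have -> : (1 + - (1 + W)^-1) * de k = W * de k / (1 + W) by field; rewrite gt_eqF.
rewrite ler_pdivlMr //; have := step k; lra.
Qed.

(** * Linear convergence of the tensor method *)

Theorem theorem4 (R : realType) (n p : nat) (B : 'M[R]_n)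
  (f : 'rV[R]_n -> R) (h : 'rV[R]_n -> \bar R) (U : set 'rV[R]_n)
  (Lp sigma q : R) (xstar : 'rV[R]_n) (x : nat -> 'rV[R]_n) :
  spd B ->
  (2 <= p)%N ->
  proper_fun h -> closed_fun h -> ext_convex h ->
  open U -> convex_set_on U -> domh h `<=` U ->
  convex_on U f -> diffn p U f ->
  0 < Lp ->
  (forall y z u, domh h y -> domh h z -> Bnorm B u <= 1 ->
     `|Dd p u f y - Dd p u f z| <= Lp * Bnorm B (y - z)) ->
  let F := fun y => ((f y)%:E + h y)%E in
  0 < sigma -> 2 <= q -> q <= p.+1%:R ->
  (forall y z gy gz, domh h y -> domh h z -> subdiff F y gy -> subdiff F z gz ->
     dualp (gy - gz) (y - z) >= sigma * Bnorm B (y - z) `^ q) ->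
  domh h xstar -> (forall y, (F xstar <= F y)%E) ->
  domh h (x 0%N) ->
  (let H := p%:R * Lp in
   forall k, forall y,
     ((taylor p f (x k) (x k.+1) + H / (p.+1)`!%:R * Bnorm B (x k.+1 - x k) ^+ p.+1)%:E
        + h (x k.+1)
      <= (taylor p f (x k) y + H / (p.+1)`!%:R * Bnorm B (y - x k) ^+ p.+1)%:E + h y)%E) ->
  let S := [set Bnorm B (y - xstar) | y in [set y | domh h y /\ (F y <= F (x 0%N))%E]] in
  has_ubound S ->
  let D := sup S in
  let omega := (p.+1%:R / p`!%:R) * ((q - 1) / q) `^ (q - 1)
                 * (Lp * D `^ (p%:R - q + 1) / sigma) in
  (forall k : nat, (1 <= k)%N ->
     (F (x k) - F xstar <=
        (expR (- (k%:R / (1 + omega `^ (p%:R^-1)))))%:E * (F (x 0%N) - F xstar))%E)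
  /\
  (forall eps : R, 0 < eps -> forall K : nat,
     K%:Z = (Num.ceil ((1 + omega `^ (p%:R^-1))
                        * ln (fine (F (x 0%N) - F xstar)%E / eps)) + 1)%R ->
     (F (x K) - F xstar <= eps%:E)%E).
Proof.
move=> B_spd p2 [hN _] hclosed hconv Uo Uc DU fconv fdiff L0 fL F sig0 q2 qp mono Dxs xsmin Dx0 xmin S Sub D om.
case: p p2 => [//|[//|k]] _ in fdiff fL qp xmin om *.
set Dom := domh h in DU fL mono Dxs Dx0 S Sub D om *.
pose g := fun y => fine (h y).
pose Phi := fun y => f y + g y.
have hE y : Dom y -> h y = (g y)%:E.
  by move=> Dy; rewrite /g fineK // fin_numE hN /= lt_eqF.
have hNy y : ~ Dom y -> h y = +oo%E.
  by move=> nD; apply/eqP; rewrite -leye_eq leNgt; apply/negP.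
have FE y : Dom y -> F y = (Phi y)%:E by move=> Dy; rewrite /F hE.
have FNy y : ~ Dom y -> F y = +oo%E by move=> nD; rewrite /F hNy // addeyl.
have hcomb y z (t : R) : 0 < t < 1 -> Dom y -> Dom z ->
    (h (t *: y + (1 - t) *: z)%R <= (t * g y + (1 - t) * g z)%R%:E)%E.
  move=> t01 Dy Dz; apply: le_trans (hconv y z t t01) _.
  by rewrite (hE _ Dy) (hE _ Dz) -!EFinM -EFinD.
(* Convexity of [h] is stated for [0 < t < 1], that of real functions on the closed interval; the
   endpoints are added here. *)
have ends (P : R -> Prop) : P 0 -> P 1 -> (forall t : R, 0 < t < 1 -> P t) ->
    forall t : R, 0 <= t <= 1 -> P t.
  move=> P0 P1 Pt t /andP[]; rewrite le_eqVlt => /orP[/eqP<- //|t0].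
  by rewrite le_eqVlt => /orP[/eqP-> //|t1]; apply: Pt; rewrite t0.
have Dc : convex_set_on Dom.
  move=> y z t Dy Dz; move: t; apply: ends.
  - by rewrite scale0r add0r subr0 scale1r.
  - by rewrite scale1r subrr scale0r addr0.
  - by move=> t t01; exact: le_lt_trans (hcomb _ _ _ t01 Dy Dz) (ltry _).
have gc : convex_on Dom g.
  move=> y z t Dy Dz; move: t; apply: ends.
  - by rewrite scale0r add0r subr0 scale1r mul0r mul1r add0r.
  - by rewrite scale1r subrr scale0r addr0 mul0r mul1r addr0.
  - move=> t t01; have t01' : 0 <= t <= 1 by case/andP: t01 => *; rewrite !ltW.
    by have := hcomb _ _ _ t01 Dy Dz; rewrite hE ?lee_fin //; exact: Dc.
have Phic : convex_on Dom Phi.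
  move=> y z t Dy Dz t01; have := gc _ _ _ Dy Dz t01.
  have := fconv _ _ _ (DU _ Dy) (DU _ Dz) t01; rewrite /Phi; lra.
have fd y : U y -> differentiable f y := fdiff.1 y.
have Phi_cl := closed_epi_add hN hclosed DU Dxs fconv fd.
have Phi_min y : Dom y -> Phi xstar <= Phi y.
  by move=> Dy; have := xsmin y; rewrite !FE // lee_fin.
have subF y G : Dom y -> subgrad B Dom Phi y G -> subdiff F y (G *m B).
  move=> Dy sG z; have [Dz|nDz] := pselect (Dom z); last by rewrite (FNy _ nDz) leey.
  by rewrite !FE // -EFinD lee_fin dualp_bform; exact: sG.
have smono y z Gy Gz : Dom y -> Dom z -> subgrad B Dom Phi y Gy -> subgrad B Dom Phi z Gz ->
    sigma * Bnorm B (y - z) `^ q <= bform B (Gy - Gz) (y - z).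
  move=> Dy Dz sy sz; rewrite -dualp_bform mulmxBl.
  by apply: mono => //; exact: subF.
have xmin' i y : Dom (x i) -> Dom (x i.+1) /\ (Dom y ->
    taylor k.+2 f (x i) (x i.+1) + k.+2%:R * Lp / k.+3`!%:R * Bnorm B (x i.+1 - x i) ^+ k.+3 + g (x i.+1)
    <= taylor k.+2 f (x i) y + k.+2%:R * Lp / k.+3`!%:R * Bnorm B (y - x i) ^+ k.+3 + g y).
  move=> Di; have DS : Dom (x i.+1).
    (* Comparison with [y = x i], where the model is finite, keeps the next iterate in the
       domain. *)
    by apply: contrapT => nD; have := xmin i (x i); rewrite (hNy _ nD) (hE _ Di) addey // -EFinD.
  split=> // Dy; have := xmin i y.
  by rewrite (hE _ DS) (hE _ Dy) -!EFinD lee_fin.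
have Dxi i : Dom (x i) by elim: i => // i IH; have [] := xmin' i (x i) IH.
have q1 : 1 < q by lra.
(* Iterates stay in the initial level set because the values decrease, so [D] bounds their distance
   to [xstar]. *)
have Dge y : Dom y -> Phi y <= Phi (x 0%N) -> Bnorm B (y - xstar) <= D.
  move=> Dy yx; apply: ub_le_sup => //; exists y => //; split=> //.
  by rewrite !FE // lee_fin.
have c0 : 0 < Lp / k.+2`!%:R by rewrite divr_gt0 // ltr0n fact_gt0.
pose de i := Phi (x i) - Phi xstar.
have de0 i : 0 <= de i by rewrite subr_ge0 Phi_min.
have step_i i : exists2 G, Bnorm B (G + (k.+2%:R * (Lp / k.+2`!%:R) *
    Bnorm B (x i.+1 - x i) ^+ k.+1) *: (x i.+1 - x i)) <= Lp / k.+2`!%:R * Bnorm B (x i.+1 - x i) ^+ k.+2 &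
    subgrad B Dom Phi (x i.+1) G.
  exact: (step_subgradient B_spd Uo fdiff DU Dc (ltW L0) fconv gc fL (Dxi i) (Dxi i.+1)
    (fun z Dz => (xmin' i z (Dxi i)).2 Dz)).
have decr i : Phi (x i.+1) <= Phi (x i).
  have [G /(step_inner_ge B_spd c0)[GY _] sG] := step_i i.
  have := sG _ (Dxi i); rewrite -(opprB (x i.+1) (x i)) bformNr; lra.
have decr0 i : Phi (x i) <= Phi (x 0%N).
  by elim: i => // i IH; exact: le_trans (decr i) IH.
pose W := om `^ (k.+2%:R^-1).
have stepW i : de i.+1 <= W * (de i - de i.+1).
  have [G /(step_inner_ge B_spd c0)[GY GN] sG] := step_i i.
  have uc := uniform_convex_lower B_spd Dc Phic Phi_cl Phi_min sig0 q1 smono Dxs (Dxi i.+1) sG.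
  have deG : de i.+1 <= Bnorm B G * Bnorm B (x i.+1 - xstar)
      - sigma / q * Bnorm B (x i.+1 - xstar) `^ q.
    by apply: le_trans uc _; rewrite lerD2r bform_le.
  have NY : 0 <= - bform B G (x i.+1 - x i) by rewrite oppr_ge0.
  have := gradient_to_decrease q2 qp sig0 L0 (Bnorm_ge0 B G) (Bnorm_ge0 B _)
    (Dge _ (Dxi i.+1) (decr0 _)) (de0 i.+1) deG NY GN.
  move=> /le_trans; apply; rewrite ler_wpM2l ?powR_ge0 //.
  have := sG _ (Dxi i); rewrite -(opprB (x i.+1) (x i)) bformNr /de; lra.
have W0 : 0 <= W := powR_ge0 _ _.
have rate := geometric_exp_rate W0 de0 stepW.
have FdE i : (F (x i) - F xstar)%E = (de i)%:E by rewrite !FE // -EFinB.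
split=> [i _|eps eps0 K KE].
  by rewrite !FdE -EFinM lee_fin; exact: rate.
move: KE; rewrite !FdE /= -/W => KE; rewrite lee_fin.
have W1 : 0 < 1 + W by lra.
(* With zero initial gap the logarithm is a default value and [KE] says nothing useful, but the rate
   already gives the bound. *)
have [d0|d0] := eqVneq (de 0%N) 0.
  by apply: le_trans (rate K) _; rewrite d0 mulr0 ltW.
have dp : 0 < de 0%N by rewrite lt0r d0 de0.
have KR : (1 + W) * ln (de 0%N / eps) <= K%:R.
  apply: le_trans (ceil_ge _) _.
  have -> : (K%:R : R) = (K%:Z)%:~R by [].
  by rewrite ler_int KE lerDl.
apply: le_trans (rate K) _.
rewrite -ler_pdivlMr // -[leRHS]lnK ?posrE ?divr_gt0 // ler_expR.
rewrite lerNl -lnV ?posrE ?divr_gt0 // invf_div ler_pdivlMr // mulrC.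
exact: KR.
Qed.
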